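(* Let $(M,\varphi_i,\xi_i,\eta_i,g)$, $i=1,2,3$, be an almost $3$-contact metric manifold and let $\varphi$ be an almost contact metric structure in the associated sphere $\Sigma_M$, with fundamental form $\Phi$. Then $M$ admits a $\varphi$-compatible connection if and only if the following conditions are satisfied: (i) the tensor field $N_\varphi$ is skew-symmetric on $\mathcal H$; (ii) $(\mathcal L_{\xi_i}g)(X,Y)=0$ for every $X,Y\in\Gamma(\mathcal H)$ and $i=1,2,3$; (iii) $(\mathcal L_Xg)(\xi_i,\xi_j)=0$ for every $X\in\Gamma(\mathcal H)$ and $i,j=1,2,3$. Moreover, the torsion $T$ of any $\varphi$-compatible connection satisfies, for all $X,Y,Z\in\Gamma(\mathcal H)$ and $i,j=1,2,3$, $$T(X,Y,Z)=N_\varphi(X,Y,Z)-d\Phi(\varphi X,\varphi Y,\varphi Z),$$ $$T(X,Y,\xi_i)=d\eta_i(X,Y),\qquad T(X,\xi_i,\xi_j)=-g([\xi_i,\xi_j],X).$$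
   Context: An almost contact metric structure $(\varphi,\xi,\eta,g)$ consists of a $(1,1)$-tensor field $\varphi$, a vector field $\xi$, a $1$-form $\eta$ and a Riemannian metric $g$ with $\varphi^2=-I+\eta\otimes\xi$, $\eta(\xi)=1$, $g(\varphi X,\varphi Y)=g(X,Y)-\eta(X)\eta(Y)$. Its fundamental form is $\Phi(X,Y)=g(X,\varphi Y)$, and $N_\varphi(X,Y)=[\varphi X,\varphi Y]+\varphi^2[X,Y]-\varphi[\varphi X,Y]-\varphi[X,\varphi Y]+d\eta(X,Y)\xi$, $N_\varphi(X,Y,Z)=g(N_\varphi(X,Y),Z)$. An almost $3$-contact metric manifold $(M,\varphi_i,\xi_i,\eta_i,g)$, $i=1,2,3$, is a manifold of dimension $4n+3$ with three almost contact metric structures with the same $g$ such that, for every even permutation $(i,j,k)$ of $(1,2,3)$, $\varphi_k=\varphi_i\varphi_j-\eta_j\otimes\xi_i=-\varphi_j\varphi_i+\eta_i\otimes\xi_j$, $\xi_k=\varphi_i\xi_j=-\varphi_j\xi_i$, $\eta_k=\eta_i\circ\varphi_j=-\eta_j\circ\varphi_i$. Set $\mathcal H=\bigcap_i\ker\eta_i$, $\mathcal V=\langle\xi_1,\xi_2,\xi_3\rangle$, so $TM=\mathcal H\oplus\mathcal V$. The associated sphere $\Sigma_M$ consists of all almost contact metric structures $\varphi_a=\sum a_i\varphi_i$, $\xi_a=\sum a_i\xi_i$, $\eta_a=\sum a_i\eta_i$ with $a\in S^2\subset\mathbb R^3$ (and metric $g$). $N_\varphi$ is skew-symmetric on $\mathcal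 H$ if $N_\varphi(X,Y,Z)$, restricted to $X,Y,Z\in\Gamma(\mathcal H)$, is a $3$-form on $\mathcal H$. A metric connection $\nabla$ has skew torsion if $T(X,Y,Z)=g(T(X,Y),Z)$ is a $3$-form. For $\varphi\in\Sigma_M$, a $\varphi$-compatible connection is a metric connection with skew torsion that preserves the splitting $TM=\mathcal H\oplus\mathcal V$ and satisfies $(\nabla_X\varphi)Y=0$ for all $X,Y\in\Gamma(\mathcal H)$. Conventions: $d\eta(X,Y)=X(\eta(Y))-Y(\eta(X))-\eta([X,Y])$, and analogously (no numerical factors) for forms of higher degree. *)

(* Defs.v *)
From HB Require Import structures.
From mathcomp Require Import all_boot all_order all_algebra all_fingroup.
From mathcomp Require Import all_classical all_reals all_analysis.

Set Implicit Arguments.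
Unset Strict Implicit.
Unset Printing Implicit Defensive.

Import Order.TTheory GRing.Theory Num.Theory.
Import numFieldNormedType.Exports.
Local Open Scope classical_set_scope.
Local Open Scope ring_scope.

Lemma near_eq_continuous (T V : topologicalType) (f g : T -> V) (x : T) :
  {near x, f =1 g} -> {for x, continuous f} -> {for x, continuous g}.
Proof.
move=> fg cf; rewrite /prop_for/continuous_at -(nbhs_singleton fg).
exact: cvg_trans (near_eq_cvg fg) cf.
Qed.

Section smooth_functions_on_open_sets.
Variables (R : realType) (m : nat).
Implicit Types (U : set 'rV[R]_m) (f g : 'rV[R]_m -> R) (k : nat).

(* Meaningful for U open. *)
Fixpoint Ck_on k U f : Prop :=
  (forall x, U x -> {for x, continuous f}) /\
  if k is k'.+1 then
    forall i : 'I_m,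
      (forall x, U x -> derivable f x (delta_mx 0 i)) /\
      Ck_on k' U (fun x => 'D_(delta_mx 0 i) f x)
  else True.

Definition smooth_on U f : Prop := forall k, Ck_on k U f.

Lemma Ck_on_cont k U f : Ck_on k U f -> forall x, U x -> {for x, continuous f}.
Proof. by case: k => [|k] []. Qed.

Lemma Ck_onW k U f : Ck_on k.+1 U f -> Ck_on k U f.
Proof.
elim: k f => [|k IHk] f [cf df]; split=> //.
by move=> i; have [dif /IHk] := df i.
Qed.

Lemma Ck_on_eq k U f g : open U -> (forall x, U x -> f x = g x) ->
  Ck_on k U f -> Ck_on k U g.
Proof.
move=> oU; elim: k f g => [|k IHk] f g fg [cf df].
all: have fgn x : U x -> {near x, f =1 g}
  by move=> Ux; apply: filterS (open_nbhs_nbhs (conj oU Ux)) => y; exact: fg.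
all: have cg x : U x -> {for x, continuous g}
  by move=> Ux; exact: near_eq_continuous (fgn x Ux) (cf x Ux).
  by [].
split=> // i; have [dif Dif] := df i; split.
  by move=> x Ux; apply: near_eq_derivable (fgn x Ux) (dif x Ux).
apply: IHk Dif => x Ux; exact: near_eq_derive (fgn x Ux).
Qed.

Lemma Ck_on_cst k U (a : R) : open U -> Ck_on k U (cst a).
Proof.
move=> oU; elim: k a => [|k IHk] a.
  by split=> // x _; exact: cst_continuous.
split=> [x _|i]; first exact: cst_continuous.
split=> [x _|]; first exact: derivable_cst.
by apply: (Ck_on_eq oU _ (IHk 0)) => x _; rewrite derive_cst.
Qed.

Lemma Ck_on_add k U f g : open U ->
  Ck_on k U f -> Ck_on k U g -> Ck_on k U (f \+ g).
Proof.
move=> oU; elim: k f g => [|k IHk] f g [cf df] [cg dg]; split=> //.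
- by move=> x Ux; exact: continuousD (cf x Ux) (cg x Ux).
- by move=> x Ux; exact: continuousD (cf x Ux) (cg x Ux).
move=> i; have [dif Dif] := df i; have [dig Dig] := dg i; split.
  by move=> x Ux; apply: derivableD; [exact: dif|exact: dig].
apply: (Ck_on_eq oU _ (IHk _ _ Dif Dig)) => x Ux /=.
by rewrite deriveD//; [exact: dif|exact: dig].
Qed.

Lemma Ck_on_mul k U f g : open U ->
  Ck_on k U f -> Ck_on k U g -> Ck_on k U (f \* g).
Proof.
move=> oU; elim: k f g => [|k IHk] f g Cf Cg.
  case: Cf Cg => cf _ [cg _]; split=> // x Ux.
  by exact: continuousM (cf x Ux) (cg x Ux).
have Cf' := Ck_onW Cf; have Cg' := Ck_onW Cg.
case: Cf Cg => cf df [cg dg]; split.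
  by move=> x Ux; exact: continuousM (cf x Ux) (cg x Ux).
move=> i; have [dif Dif] := df i; have [dig Dig] := dg i; split.
  by move=> x Ux; apply: derivableM; [exact: dif|exact: dig].
have H := Ck_on_add oU (IHk _ _ Cf' Dig) (IHk _ _ Cg' Dif).
apply: (Ck_on_eq oU _ H) => x Ux /=.
by rewrite deriveM//; [exact: dif|exact: dig].
Qed.

End smooth_functions_on_open_sets.

Record chart (R : realType) (m : nat) (M : topologicalType) := Chart {
  chart_dom : set M;
  chart_cod : set 'rV[R]_m;
  chart_fun :> M -> 'rV[R]_m;
  chart_inv : 'rV[R]_m -> M;
  chart_dom_open : open chart_dom;
  chart_cod_open : open chart_cod;
  chart_funP : forall p, chart_dom p -> chart_cod (chart_fun p);
  chart_invP : forall x, chart_cod x -> chart_dom (chart_inv x);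
  chart_funK : forall p, chart_dom p -> chart_inv (chart_fun p) = p;
  chart_invK : forall x, chart_cod x -> chart_fun (chart_inv x) = x;
  chart_fun_cont : {within chart_dom, continuous chart_fun};
  chart_inv_cont : {within chart_cod, continuous chart_inv} }.

(* The atlas need not be maximal. *)
Record manifold (R : realType) (m : nat) := Manifold {
  manifold_carrier :> topologicalType;
  manifold_hausdorff : hausdorff_space manifold_carrier;
  manifold_second_countable : @second_countable manifold_carrier;
  atlas : set (chart R m manifold_carrier);
  atlas_cover : forall p : manifold_carrier, exists2 c, atlas c & chart_dom c p;
  atlas_compatible : forall c d, atlas c -> atlas d -> forall i : 'I_m,
    smooth_on (chart_cod c `&` chart_inv c @^-1` chart_dom d)
              (fun x => d (chart_inv c x) 0 i) }.

Section smooth_functions.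
Variables (R : realType) (m : nat) (M : manifold R m).

Definition smooth : {pred M -> R} := mem [set f : M -> R |
  forall c, atlas (m := m) c -> smooth_on (chart_cod c) (f \o chart_inv c)].

Fact smooth_subring : subring_closed smooth.
Proof.
have cstP a : cst a \in smooth.
  by rewrite inE => c _ k; apply: Ck_on_cst; exact: chart_cod_open.
have mulP : {in smooth &, forall f g, f * g \in smooth}.
  move=> f g; rewrite !inE => fP gP c Mc k.
  by apply: Ck_on_mul; [exact: chart_cod_open|exact: fP|exact: gP].
split; [exact: cstP| |exact: mulP].
move=> f g; rewrite !inE => fP gP c Mc k.
have oc := @chart_cod_open _ _ _ c.
have ngP := Ck_on_mul oc (Ck_on_cst k (-1) oc) (gP c Mc k).
apply: (Ck_on_eq oc _ (Ck_on_add oc (fP c Mc k) ngP)) => x _ /=.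
by rewrite mulN1r.
Qed.

HB.instance Definition _ := GRing.isSubringClosed.Build _ smooth smooth_subring.

Fact smooth_scaler : GRing.scaler_closed smooth.
Proof.
move=> a f; rewrite !inE => fP c Mc k.
apply: (@Ck_on_mul _ _ _ _ (cst a)); [exact: chart_cod_open| |exact: fP].
by apply: Ck_on_cst; exact: chart_cod_open.
Qed.

HB.instance Definition _ := GRing.isScaleClosed.Build _ _ smooth smooth_scaler.

Record smoothfun := SmoothFun {
  smoothfun_val :> M -> R;
  smoothfunP : smoothfun_val \in smooth }.

HB.instance Definition _ := [isSub for smoothfun_val].
HB.instance Definition _ := [Choice of smoothfun by <:].
HB.instance Definition _ := 
  GRing.SubChoice_isSubComPzRing.Build _ _ smoothfun (subringClosedP _).
HB.instance Definition _ := [SubZmodule_isSubLmodule of smoothfun by <:].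

End smooth_functions.

Definition smooth_cst (R : realType) (m : nat) (M : manifold R m) (a : R) :
  smoothfun M := a *: (1 : smoothfun M).

Section vector_fields.
Variables (R : realType) (m : nat) (M : manifold R m).

Definition leibniz (D : smoothfun M -> smoothfun M) :=
  forall f h, D (f * h) = D f * h + f * D h.

(* Vector fields are the derivations of the real algebra of smooth functions;
   the value of X at p is the tangent vector f |-> X f p. *)
Record vfield := VField {
  vfield_fun :> smoothfun M -> smoothfun M;
  vfield_linear : linear vfield_fun;
  vfield_leibniz : leibniz vfield_fun }.

Lemma vfieldP (X Y : vfield) : (forall f, X f = Y f) -> X = Y.
Proof.
case: X Y => [X Xl XM] [Y Yl YM] /= /funext XY.
move: Xl XM; rewrite XY => Xl XM.
by congr VField; exact: Prop_irrelevance.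
Qed.

HB.instance Definition _ (X : vfield) :=
  GRing.isLinear.Build R (smoothfun M) (smoothfun M) _ X (vfield_linear X).

HB.instance Definition _ := gen_eqMixin vfield.
HB.instance Definition _ := gen_choiceMixin vfield.

Definition vf_at (X : vfield) (p : M) : smoothfun M -> R := fun f => X f p.

Fact smooth_scalerAr (a : R) (f h : smoothfun M) : a *: (f * h) = f * (a *: h).
Proof. by apply/val_inj/funext => p /=; exact: mulrCA. Qed.

Fact vf_zero_linear : linear (fun _ : smoothfun M => 0 : smoothfun M).
Proof. by move=> a f h; rewrite scaler0 addr0. Qed.
Fact vf_zero_leibniz : leibniz (fun=> 0).
Proof. by move=> f h; rewrite mul0r mulr0 addr0. Qed.
Definition vf_zero := VField vf_zero_linear vf_zero_leibniz.

Fact vf_opp_linear (X : vfield) : linear (fun f => - X f).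
Proof. by move=> a f h; rewrite linearP opprD scalerN. Qed.
Fact vf_opp_leibniz (X : vfield) : leibniz (fun f => - X f).
Proof. by move=> f h; rewrite vfield_leibniz opprD mulNr mulrN. Qed.
Definition vf_opp X := VField (vf_opp_linear X) (@vf_opp_leibniz X).

Fact vf_add_linear (X Y : vfield) : linear (fun f => X f + Y f).
Proof. by move=> a f h; rewrite !linearP scalerDr addrACA. Qed.
Fact vf_add_leibniz (X Y : vfield) : leibniz (fun f => X f + Y f).
Proof. by move=> f h; rewrite !vfield_leibniz mulrDl mulrDr addrACA. Qed.
Definition vf_add X Y := VField (vf_add_linear X Y) (@vf_add_leibniz X Y).

Fact vf_scale_linear (u : smoothfun M) (X : vfield) : linear (fun f => u * X f).
Proof. by move=> a f h; rewrite linearP mulrDr smooth_scalerAr. Qed.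
Fact vf_scale_leibniz (u : smoothfun M) (X : vfield) :
  leibniz (fun f => u * X f).
Proof. by move=> f h; rewrite vfield_leibniz mulrDr mulrA (mulrCA u). Qed.
Definition vf_scale u X := VField (vf_scale_linear u X) (@vf_scale_leibniz u X).

Fact lie_linear (X Y : vfield) : linear (fun f => X (Y f) - Y (X f)).
Proof. by move=> a f h; rewrite !linearD !linearZ /= addrACA. Qed.
Fact lie_leibniz (X Y : vfield) : leibniz (fun f => X (Y f) - Y (X f)).
Proof.
move=> f h; rewrite !vfield_leibniz [X (_ + _)]linearD [Y (_ + _)]linearD.
rewrite /= !vfield_leibniz mulrBl mulrBr.
rewrite [Y (X f) * h + _ + _]addrACA opprD addrACA !opprD; congr (_ + _).
  by rewrite addrACA subrr addr0.
by rewrite addrACA subrr add0r.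
Qed.
Definition lie X Y := VField (lie_linear X Y) (@lie_leibniz X Y).

Fact vf_addA : associative vf_add.
Proof. by move=> X Y Z; apply: vfieldP => f; exact: addrA. Qed.
Fact vf_addC : commutative vf_add.
Proof. by move=> X Y; apply: vfieldP => f; exact: addrC. Qed.
Fact vf_add0 : left_id vf_zero vf_add.
Proof. by move=> X; apply: vfieldP => f; exact: add0r. Qed.
Fact vf_addN : left_inverse vf_zero vf_opp vf_add.
Proof. by move=> X; apply: vfieldP => f; exact: addNr. Qed.

HB.instance Definition _ :=
  GRing.isZmodule.Build vfield vf_addA vf_addC vf_add0 vf_addN.

Fact vf_scaleA u v X : vf_scale u (vf_scale v X) = vf_scale (u * v) X.
Proof. by apply: vfieldP => f; exact: mulrA. Qed.
Fact vf_scale1 : left_id 1 vf_scale.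
Proof. by move=> X; apply: vfieldP => f; exact: mul1r. Qed.
Fact vf_scaleDr : right_distributive vf_scale +%R.
Proof. by move=> u X Y; apply: vfieldP => f; exact: mulrDr. Qed.
Fact vf_scaleDl X : {morph vf_scale^~ X : u v / u + v}.
Proof. by move=> u v; apply: vfieldP => f; exact: mulrDl. Qed.

HB.instance Definition _ := GRing.Zmodule_isLmodule.Build
  (smoothfun M) vfield vf_scaleA vf_scale1 vf_scaleDr vf_scaleDl.

End vector_fields.

(* Tensor fields are maps that are multilinear over the ring of smooth
   functions. *)
Section riemannian_geometry.
Variables (R : realType) (m : nat) (M : manifold R m).
Implicit Types (X Y Z : vfield M) (D : set (vfield M)).

Record riem_metric := RiemMetric {
  riem_fun :> vfield M -> vfield M -> smoothfun M;
  riem_sym : forall X Y, riem_fun X Y = riem_fun Y X;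
  riem_linear : forall X, scalar (riem_fun X);
  riem_pos : forall X (p : M),
    vf_at X p <> (fun=> 0) -> 0 < riem_fun X X p }.

Definition ext_d1 (eta : vfield M -> smoothfun M) X Y : smoothfun M :=
  X (eta Y) - Y (eta X) - eta (lie X Y).

Definition ext_d2 (w : vfield M -> vfield M -> smoothfun M) X Y Z :
    smoothfun M :=
  X (w Y Z) - Y (w X Z) + Z (w X Y)
  - w (lie X Y) Z + w (lie X Z) Y - w (lie Y Z) X.

Definition lie_metric Z (g : riem_metric) X Y : smoothfun M :=
  Z (g X Y) - g (lie Z X) Y - g X (lie Z Y).

(* D stands for the space of sections of a subbundle of TM. *)
Definition form3_on D (w : vfield M -> vfield M -> vfield M -> smoothfun M) :=
  [/\ forall (f : smoothfun M) X X' Y Z, D X -> D X' -> D Y -> D Z ->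
        w (f *: X + X') Y Z = f * w X Y Z + w X' Y Z,
      forall (f : smoothfun M) X Y Y' Z, D X -> D Y -> D Y' -> D Z ->
        w X (f *: Y + Y') Z = f * w X Y Z + w X Y' Z,
      forall (f : smoothfun M) X Y Z Z', D X -> D Y -> D Z -> D Z' ->
        w X Y (f *: Z + Z') = f * w X Y Z + w X Y Z' &
      forall X Y Z, D X -> D Y -> D Z ->
        w X Y Z = - w Y X Z /\ w X Y Z = - w X Z Y].

Record connection := Connection {
  nabla :> vfield M -> vfield M -> vfield M;
  nabla_linear : forall Y, linear (nabla^~ Y);
  nabla_add : forall X Y Z, nabla X (Y + Z) = nabla X Y + nabla X Z;
  nabla_leibniz : forall X (f : smoothfun M) Y,
    nabla X (f *: Y) = X f *: Y + f *: nabla X Y }.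

Definition torsion (nb : connection) X Y : vfield M :=
  nb X Y - nb Y X - lie X Y.

Definition torsion3 (g : riem_metric) (nb : connection) X Y Z : smoothfun M :=
  g (torsion nb X Y) Z.

Definition metric_connection (g : riem_metric) (nb : connection) :=
  forall X Y Z, X (g Y Z) = g (nb X Y) Z + g Y (nb X Z).

Definition skew_torsion (g : riem_metric) (nb : connection) :=
  form3_on setT (torsion3 g nb).

Record acm_structure (g : riem_metric) := AcmStructure {
  acm_phi : {linear vfield M -> vfield M};
  acm_xi : vfield M;
  acm_eta : {scalar vfield M};
  acm_phi2 : forall X, acm_phi (acm_phi X) = - X + acm_eta X *: acm_xi;
  acm_eta_xi : acm_eta acm_xi = 1;
  acm_metric : forall X Y,
    g (acm_phi X) (acm_phi Y) = g X Y - acm_eta X * acm_eta Y }.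

Definition fundamental_form g (s : acm_structure g) X Y : smoothfun M :=
  g X (acm_phi s Y).

Definition nijenhuis g (s : acm_structure g) X Y : vfield M :=
  lie (acm_phi s X) (acm_phi s Y) + acm_phi s (acm_phi s (lie X Y))
  - acm_phi s (lie (acm_phi s X) Y) - acm_phi s (lie X (acm_phi s Y))
  + ext_d1 (acm_eta s) X Y *: acm_xi s.

Definition nijenhuis3 g (s : acm_structure g) X Y Z : smoothfun M :=
  g (nijenhuis s X Y) Z.

End riemannian_geometry.

Section almost_3_contact.
Variables (R : realType) (n : nat) (M : manifold R (4 * n + 3)).
Variable g : riem_metric M.
Implicit Types X Y : vfield M.

(* The indices 1, 2, 3 are the elements 0, 1, 2 of 'I_3, and the permutation s
   stands for the triple (s 0, s 1, s 2). *)
Record almost_3contact := Almost3Contact {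
  acm3 :> 'I_3 -> acm_structure g;
  acm3_compat : forall s : 'S_3, ~~ odd_perm s ->
    let si := acm3 (s 0) in let sj := acm3 (s 1) in let sk := acm3 (s 2) in
    [/\ forall X, acm_phi sk X =
          acm_phi si (acm_phi sj X) - acm_eta sj X *: acm_xi si,
        forall X, acm_phi sk X =
          - acm_phi sj (acm_phi si X) + acm_eta si X *: acm_xi sj,
        acm_xi sk = acm_phi si (acm_xi sj) /\
        acm_xi sk = - acm_phi sj (acm_xi si),
        forall X, acm_eta sk X = acm_eta si (acm_phi sj X) &
        forall X, acm_eta sk X = - acm_eta sj (acm_phi si X)] }.

Variable S : almost_3contact.

(* Sections of the horizontal and of the vertical distribution. *)
Definition horizontal : set (vfield M) :=
  [set X | forall i, acm_eta (S i) X = 0].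

Definition vertical : set (vfield M) :=
  [set X | forall p : M, exists c : 'I_3 -> R,
    vf_at X p = (fun f => \sum_i c i * vf_at (acm_xi (S i)) p f)].

Definition assoc_sphere : set (acm_structure g) :=
  [set s | exists a : 'I_3 -> R,
    [/\ \sum_i a i ^+ 2 = 1,
        forall X, acm_phi s X = \sum_i smooth_cst M (a i) *: acm_phi (S i) X,
        acm_xi s = \sum_i smooth_cst M (a i) *: acm_xi (S i) &
        forall X, acm_eta s X = \sum_i smooth_cst M (a i) * acm_eta (S i) X]].

Definition compatible_connection (s : acm_structure g) (nb : connection M) :=
  [/\ metric_connection g nb,
      skew_torsion g nb,
      forall X Y, horizontal Y -> horizontal (nb X Y),
      forall X Y, vertical Y -> vertical (nb X Y) &
      forall X Y, horizontal X -> horizontal Y ->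
        nb X (acm_phi s Y) - acm_phi s (nb X Y) = 0].

End almost_3_contact.

(* Main.v *)
(* For a metric connection with skew torsion T, put
   b(X;Y,Z) = g((nabla_X phi) Y, Z). On the horizontal distribution both N_phi
   and d Phi split into a part linear in T and a part linear in b, and
   T = N_phi - d Phi(phi, phi, phi) is equivalent to
   b(X;Y,phi Z) - b(Y;X,phi Z) - b(phi Z;X,Y) = 0. For compatible nabla, b = 0:
   this gives the formula for T and the skew symmetry of N_phi. Conversely, the
   prescribed values define a 3-form T, the Koszul formula gives the metric
   connection with torsion T, (ii) and (iii) make it preserve the splitting, and
   the identity above together with the skew symmetry of N_phi forces b = 0.

   The Koszul formula needs the Riesz representation of 1-forms. As vector
   fields are derivations, this rests on Hadamard's lemma: on a cube of a chart
   with bump function psi, one has psi^3 Y = sum_i a_i E_i for every vector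
   field Y, where E_i = psi d_i and the a_i are smooth. The Gram matrix of the
   E_i then represents a 1-form up to a smooth factor that does not vanish near
   a given point, and nondegeneracy of g glues the local quotients. *)
Require Import Defs.
From HB Require Import structures.
From mathcomp Require Import all_boot all_order all_algebra all_fingroup.
From mathcomp Require Import all_classical all_reals all_analysis.
From mathcomp Require Import ring lra.

Set Implicit Arguments.
Unset Strict Implicit.
Unset Printing Implicit Defensive.

Import Order.TTheory GRing.Theory Num.Theory.
Import numFieldNormedType.Exports.
Local Open Scope classical_set_scope.
Local Open Scope ring_scope.

(** * Calculus on open subsets of R^m *)

Section row_vectors.
Variables (R : realType) (m : nat).
Implicit Types (x y : 'rV[R]_m).

(** Why [b] is forced to vanish: the [b]-part of N_phi is skew in its first two arguments by its
    very shape, and in the last two because both N_phi and the part linear in T are. This total skew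
    symmetry, together with the rules for moving [phi] between the slots of [b], makes two instances
    of the identity between T, N_phi and d Phi add up to 2b = 0. Why exactly (ii) and (iii): once T
    has the prescribed mixed values, the Koszul formula gives the component of nabla that mixes
    horizontal and vertical fields as half of these Lie derivatives, up to sign. The value of T on
    three vertical fields is not prescribed; it is set to zero. The obstacle on the analytic side is
    that a derivation has no components to begin with, and that the ring of smooth functions admits
    no division by a bump function or by a Gram determinant. Identities therefore keep these
    factors, and quotients are formed only at single points, where the factor is nonzero. *)

Lemma ball_rVP x y (e : R) : 0 < e ->
  ball x e y <-> forall j, `|x 0 j - y 0 j| < e.
Proof.
move=> e0; split=> [[_ h] j|h]; first exact: h.
by split=> // i j; rewrite (ord1 i); exact: h.
Qed.

Lemma cvg_rVP (T : Type) (F : set_system T) (G : T -> 'rV[R]_m) y :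
  Filter F -> (forall j, G t 0 j @[t --> F] --> y 0 j) -> G @ F --> y.
Proof.
move=> FF h; apply/cvg_ballP => e e0.
suff : \forall t \near F, forall j, `|y 0 j - G t 0 j| < e.
  by apply: filterS => t /ball_rVP; apply.
by apply: filter_forall => j; move/cvgrPdist_lt: (h j) => /(_ e e0).
Qed.

Lemma continuous_rVP (T : topologicalType) (G : T -> 'rV[R]_m) t :
  (forall j, {for t, continuous (fun u => G u 0 j)}) -> {for t, continuous G}.
Proof. by move=> h; apply: (@cvg_rVP _ _ _ _ (nbhs_filter t)). Qed.

(** The corners of a staircase from [x] to [y]: one coordinate changes at a time, so that each
    increment is controlled by a single partial derivative. *)
Definition rV_mix x y k : 'rV[R]_m :=
  \row_j if (j < k)%N then y 0 j else x 0 j.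

Lemma rV_mix0 x y : rV_mix x y 0 = x.
Proof. by apply/rowP => j; rewrite mxE. Qed.

Lemma rV_mix_size x y : rV_mix x y m = y.
Proof. by apply/rowP => j; rewrite mxE ltn_ord. Qed.

Lemma rV_mixS x y (k : 'I_m) :
  rV_mix x y k.+1 = (y 0 k - x 0 k) *: delta_mx 0 k + rV_mix x y k.
Proof.
apply/rowP => j; rewrite !mxE eqxx /= ltnS leq_eqVlt -val_eqE /=.
have [/eqP/val_inj ->|_] := boolP (j == k :> nat).
  by rewrite ltnn mulr1 subrK.
by rewrite mulr0 add0r.
Qed.

(** Balls of row vectors are cubes, hence contain every staircase from the centre to one of their
    points. *)
Lemma rV_mix_segment x y (k : 'I_m) (s e : R) : 0 < e -> ball x e y ->
  `|s| <= `|y 0 k - x 0 k| -> ball x e (s *: delta_mx 0 k + rV_mix x y k).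
Proof.
move=> e0 /ball_rVP xy sle; apply/ball_rVP => // j; rewrite !mxE eqxx /=.
have [->|jk] := eqVneq j k.
  rewrite mulr1 ltnn opprD addrCA subrr addr0 normrN.
  by rewrite (le_lt_trans sle)// distrC xy.
by rewrite mulr0 add0r; case: ifP => _; rewrite ?subrr ?normr0// xy.
Qed.

End row_vectors.

Section partial_derivatives.
Variables (R : realType) (m : nat).
Implicit Types (x y : 'rV[R]_m) (f : 'rV[R]_m -> R).

Lemma line_is_derive (V : normedModType R) (F : V -> R) (z v : V) (s : R) :
  derivable F (s *: v + z) v ->
  is_derive s 1 (fun t => F (t *: v + z)) ('D_v F (s *: v + z)).
Proof.
move=> dF.
have E : (fun h : R => h^-1 *: (((fun t => F (t *: v + z)) \o shift s) (h *: (1:R))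
   - F (s *: v + z))) =
  (fun h => h^-1 *: ((F \o shift (s *: v + z)) (h *: v) - F (s *: v + z))).
  by apply/funext => h /=; rewrite [h *: _]mulr1 scalerDl addrA.
by split; rewrite /derivable/derive E.
Qed.

(** The step [h] may have either sign; bounding the intermediate point by its absolute value covers
    both cases and is all that limits require. *)
Lemma line_MVT (V : normedModType R) (F : V -> R) (z v : V) (h : R) :
  (forall s, `|s| <= `|h| -> derivable F (s *: v + z) v) ->
  exists2 s, `|s| <= `|h| &
    F (h *: v + z) - F z = h * 'D_v F (s *: v + z).
Proof.
move=> dF; pose G t := F (t *: v + z).
have dG s : `|s| <= `|h| -> is_derive s (1 : R) (G : R -> R) ('D_v F (s *: v + z)).
  by move=> /dF; exact: line_is_derive.
have cG s : `|s| <= `|h| -> {for s, continuous G}.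
  by move=> /dG [? _]; apply: differentiable_continuous; exact/derivable1_diffP.
have [h0|h0] := leP 0 h.
  have sle s : s \in `[0, h] -> `|s| <= `|h|.
    by rewrite in_itv /= => /andP[s0 sh]; rewrite !ger0_norm.
  have [|| c ch] := @MVT_segment _ G (fun s => 'D_v F (s *: v + z)) 0 h h0.
  - by move=> s /subset_itv_oo_cc /sle; exact: dG.
  - by apply: continuous_in_subspaceT => s /set_mem /sle; exact: cG.
  rewrite /G scale0r add0r subr0 mulrC => E.
  by exists c => //; exact: sle.
have sle s : s \in `[h, 0] -> `|s| <= `|h|.
  by rewrite in_itv /= => /andP[s0 sh]; rewrite !ler0_norm ?lerN2// ltW.
have [|| c ch] := @MVT_segment _ G (fun s => 'D_v F (s *: v + z)) h 0 (ltW h0).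
- by move=> s /subset_itv_oo_cc /sle; exact: dG.
- by apply: continuous_in_subspaceT => s /set_mem /sle; exact: cG.
rewrite /G scale0r add0r sub0r mulrN mulrC => /(congr1 -%R).
rewrite opprB opprK => E.
by exists c => //; exact: sle.
Qed.

(** Differentiability in Caratheodory's form: the increment is linear in the displacement, with
    slopes continuous at [x]. The slopes are the difference quotients along the edges of the
    staircase, and the mean value theorem turns them into partial derivatives at nearby points. *)
Lemma C1_caratheodory f x :
  (\forall y \near x, forall j, derivable f y (delta_mx 0 j)) ->
  (forall j, {for x, continuous ('D_(delta_mx 0 j) f)}) ->
  exists c : 'I_m -> 'rV[R]_m -> R,
    (forall y, f y - f x = \sum_j (y 0 j - x 0 j) * c j y) /\
    forall j, c j y @[y --> x] --> 'D_(delta_mx 0 j) f x.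
Proof.
move=> df cdf.
(* On a degenerate edge the increment is zero and any slope fits; the partial derivative at [x]
   keeps the slope continuous there. *)
pose c (j : 'I_m) y := if y 0 j == x 0 j then 'D_(delta_mx 0 j) f x else
  (y 0 j - x 0 j)^-1 * (f (rV_mix x y j.+1) - f (rV_mix x y j)).
exists c; split.
  move=> y; have := telescope_sumr (fun k => f (rV_mix x y k)) (leq0n m).
  rewrite rV_mix0 rV_mix_size => <-; rewrite big_mkord.
  apply: eq_bigr => j _; rewrite /c.
  have [yx|yx] := eqVneq (y 0 j) (x 0 j).
    by rewrite rV_mixS yx subrr mul0r scale0r add0r subrr.
  by rewrite mulVKf// subr_eq0.
move=> j; apply/(@cvgrPdist_lt _ _ _ _ (nbhs_filter x)) => e e0.
have /cvgrPdist_lt/(_ e e0) := cdf j; rewrite near_simpl => near1.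
have /nbhs_ballP[d /= d0 dP] : \forall y \near x,
    (forall i, derivable f y (delta_mx 0 i)) /\
    `|'D_(delta_mx 0 j) f x - 'D_(delta_mx 0 j) f y| < e.
  exact: filterI df near1.
apply/nbhs_ballP; exists d => // y xy; rewrite /c /=.
have [yx|yx] := eqVneq (y 0 j) (x 0 j); first by rewrite subrr normr0.
rewrite rV_mixS.
have B s : `|s| <= `|y 0 j - x 0 j| -> ball x d (s *: delta_mx 0 j + rV_mix x y j).
  exact: rV_mix_segment.
have [s|s sl ->] := @line_MVT _ f (rV_mix x y j) (delta_mx 0 j) (y 0 j - x 0 j).
  by move=> /B /dP [] /(_ j).
by rewrite mulKf ?subr_eq0//; have [] := dP _ (B _ sl).
Qed.

(** With Caratheodory slopes for [f], the difference quotient of the composite is a finite sum of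
    products, each factor of which has a limit. *)
Lemma chain_rule (V : normedModType R) f (G : V -> 'rV[R]_m) (z v : V) :
  (\forall y \near G z, forall j, derivable f y (delta_mx 0 j)) ->
  (forall j, {for G z, continuous ('D_(delta_mx 0 j) f)}) ->
  (forall j, derivable (fun t => G t 0 j) z v) ->
  is_derive z v (f \o G) (\sum_j 'D_v (fun t => G t 0 j) z *
                                 'D_(delta_mx 0 j) f (G z)).
Proof.
move=> df cdf dG; have [c [cE cc]] := C1_caratheodory df cdf.
have Gc : G (h *: v + z) @[h --> 0^'] --> G z.
  apply: cvg_rVP => j.
  have /derivable1P/derivable1_diffP/differentiable_continuous H := dG j.
  have {}H : G (h *: v + z) 0 j @[h --> (0 : R)] --> G z 0 j.
    by move: H; rewrite /prop_for /continuous_at scale0r add0r.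
  exact: cvg_within_filter H.
suff L : h^-1 *: (((f \o G) \o shift z) (h *: v) - (f \o G) z) @[h --> 0^'] -->
    \sum_j 'D_v (fun t => G t 0 j) z * 'D_(delta_mx 0 j) f (G z).
  by apply: DeriveDef; [apply/cvg_ex; eexists; exact: L|exact/cvg_lim].
have -> : (fun h : R => h^-1 *: (((f \o G) \o shift z) (h *: v) - (f \o G) z)) =
   fun h => \sum_j (h^-1 *: (((fun t => G t 0 j) \o shift z) (h *: v) - G z 0 j)) *
      c j (G (h *: v + z)).
  apply/funext => h /=; rewrite cE scaler_sumr; apply: eq_bigr => j _.
  by rewrite scalerAl.
apply: cvg_big => [|j _]; first exact: add_continuous.
apply: cvgM.
  exact: dG.
exact: (cvg_comp _ _ Gc (cc j)).
Qed.

End partial_derivatives.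

(** * Closure properties of C^k functions on open sets *)

Section Ck_functions.
Variable R : realType.

Section one_domain.
Variable m : nat.
Implicit Types (U W : set 'rV[R]_m) (f g : 'rV[R]_m -> R).

Lemma Ck_on_local k U f :
  (forall x, U x -> exists W, [/\ open W, W x & Ck_on k W f]) -> Ck_on k U f.
Proof.
elim: k f => [|k IHk] f H; split=> //.
- by move=> x /H [W [_ Wx [cf _]]]; exact: cf.
- by move=> x /H [W [_ Wx [cf _]]]; exact: cf.
move=> i; split.
  by move=> x /H [W [_ Wx [_ /(_ i) [df _]]]]; exact: df.
by apply: IHk => x /H [W [oW Wx [_ /(_ i) [_ Df]]]]; exists W.
Qed.

Lemma Ck_on_subset k U W f : U `<=` W -> Ck_on k W f -> Ck_on k U f.
Proof.
move=> UW; elim: k f => [|k IHk] f [cf df]; split=> //; try by move=> x /UW/cf.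
by move=> i; have [dif Df] := df i; split; [move=> x /UW/dif|exact: IHk].
Qed.

Lemma Ck_on_derivable k U f x i : Ck_on k.+1 U f -> U x ->
  derivable f x (delta_mx 0 i).
Proof. by move=> [_ /(_ i) [df _]]; exact: df. Qed.

Lemma Ck_on_derive k U f i : Ck_on k.+1 U f ->
  Ck_on k U ('D_(delta_mx 0 i) f).
Proof. by move=> [_ /(_ i) []]. Qed.

Lemma Ck_on_sum k U (I : Type) (r : seq I) (F : I -> 'rV[R]_m -> R) : open U ->
  (forall i, Ck_on k U (F i)) -> Ck_on k U (fun x => \sum_(i <- r) F i x).
Proof.
move=> oU CF; elim: r => [|i r IHr].
  by apply: (Ck_on_eq oU _ (Ck_on_cst k 0 oU)) => x _; rewrite big_nil.
by apply: (Ck_on_eq oU _ (Ck_on_add oU (CF i) IHr)) => x _; rewrite big_cons.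
Qed.

Lemma Ck_on_prod k U (I : Type) (r : seq I) (F : I -> 'rV[R]_m -> R) : open U ->
  (forall i, Ck_on k U (F i)) -> Ck_on k U (fun x => \prod_(i <- r) F i x).
Proof.
move=> oU CF; elim: r => [|i r IHr].
  by apply: (Ck_on_eq oU _ (Ck_on_cst k 1 oU)) => x _; rewrite big_nil.
by apply: (Ck_on_eq oU _ (Ck_on_mul oU (CF i) IHr)) => x _; rewrite big_cons.
Qed.

Lemma is_derive_coord (x v : 'rV[R]_m) (j : 'I_m) :
  is_derive x v (fun y : 'rV[R]_m => y 0 j) (v 0 j).
Proof.
have E : (fun h : R => h^-1 *: (((fun y : 'rV[R]_m => y 0 j) \o shift x) (h *: v)
    - x 0 j)) @ 0^' --> v 0 j.
  apply: cvg_near_cst; near=> h.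
  rewrite /= !mxE addrK /GRing.scale /= mulKf//.
  by near: h; exact: nbhs_dnbhs_neq.
split; [apply/cvg_ex; eexists; exact: E|exact/cvg_lim].
Unshelve. all: by end_near. Qed.

Lemma Ck_on_coord k U j : open U -> Ck_on k U (fun x => x 0 j).
Proof.
move=> oU; case: k => [|k]; split=> //; try by move=> x _; exact: coord_continuous.
move=> i; split=> [x _|]; first by case: (is_derive_coord x (delta_mx 0 i) j).
apply: (Ck_on_eq oU _ (Ck_on_cst k ((delta_mx 0 i : 'rV[R]_m) 0 j) oU)) => x _.
by have [_ ->] := is_derive_coord x (delta_mx 0 i) j.
Qed.

(** The partial derivatives of 1/f are products of 1/f with itself and with derivatives of f, so the
    induction closes. *)
Lemma Ck_on_inv k U f : open U -> (forall x, U x -> f x != 0) ->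
  Ck_on k U f -> Ck_on k U (fun x => (f x)^-1).
Proof.
move=> oU f0; elim: k f f0 => [|k IHk] f f0 Cf.
  by split=> // x Ux; exact: cvgV (f0 x Ux) (Ck_on_cont Cf Ux).
split; first by move=> x Ux; exact: cvgV (f0 x Ux) (Ck_on_cont Cf Ux).
move=> i; split.
  by move=> x Ux; apply: derivableV; [exact: f0|exact: Ck_on_derivable Cf Ux].
have Cfi := IHk _ f0 (Ck_onW Cf).
have Cf2 := Ck_on_mul oU (Ck_on_cst k (-1) oU) (Ck_on_mul oU Cfi Cfi).
apply: (Ck_on_eq oU _ (Ck_on_mul oU Cf2 (Ck_on_derive i Cf))) => x Ux /=.
rewrite deriveV ?f0//; last exact: Ck_on_derivable Cf Ux.
by rewrite /GRing.scale /= -exprVn expr2 mulN1r.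
Qed.

End one_domain.

(** Induction on the order: by the chain rule a partial derivative of the composite is a sum of
    products of partials of [G] with composites of partials of [f], which have one order less. *)
Lemma Ck_on_comp m m' k (U : set 'rV[R]_m) (V : set 'rV[R]_m') f G :
  open U -> open V -> (forall x, U x -> V (G x)) ->
  (forall j, Ck_on k U (fun x => G x 0 j)) -> Ck_on k V f ->
  Ck_on k U (f \o G).
Proof.
move=> oU oV UV CG.
have cfG g : Ck_on k V g -> forall x, U x -> {for x, continuous (g \o G)}.
  move=> Cg x Ux; apply: continuous_comp; last exact (Ck_on_cont Cg (UV _ Ux)).
  by apply: continuous_rVP => j; exact (Ck_on_cont (CG j) Ux).
elim: k f CG cfG => [|k IHk] f CG cfG Cf; first by split=> //; exact: cfG.
split; first exact: cfG.
move=> i.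
have H x : U x -> is_derive x (delta_mx 0 i) (f \o G)
    (\sum_j 'D_(delta_mx 0 i) (fun t => G t 0 j) x * 'D_(delta_mx 0 j) f (G x)).
  move=> Ux; apply: chain_rule.
  - apply: filterS (open_nbhs_nbhs (conj oV (UV _ Ux))) => y Vy j.
    exact: Ck_on_derivable Cf Vy.
  - by move=> j; exact (Ck_on_cont (Ck_on_derive j Cf) (UV _ Ux)).
  - by move=> j; exact: Ck_on_derivable (CG j) Ux.
split; first by move=> x /H [].
have CDfG j : Ck_on k U ('D_(delta_mx 0 j) f \o G).
  apply: IHk (Ck_on_derive j Cf) => [l|g Cg x Ux]; first exact: Ck_onW.
  apply: continuous_comp; last exact (Ck_on_cont Cg (UV _ Ux)).
  by apply: continuous_rVP => l; exact (Ck_on_cont (CG l) Ux).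
apply: (Ck_on_eq oU _ (Ck_on_sum (index_enum 'I_m') oU (fun j =>
  Ck_on_mul oU (Ck_on_derive i (CG j)) (CDfG j)))) => x Ux /=.
by have [_ ->] := H x Ux.
Qed.

End Ck_functions.

(** * Flat functions and bump functions *)

Section flat_function.
Variable R : realType.
Implicit Types (t : R) (k : nat).

(** The case k = 0 is the usual germ of a bump function. The powers of 1/t are included because
    differentiation then stays in the linear span of the family. *)
Definition flat k t : R := if 0 < t then t^-1 ^+ k * expR (- t^-1) else 0.

Lemma flat_ge0 k t : 0 <= flat k t.
Proof.
rewrite /flat; case: ifP => // t0.
by rewrite mulr_ge0 ?expR_ge0// exprn_ge0// invr_ge0 ltW.
Qed.

Lemma flat_gt0 k t : 0 < t -> 0 < flat k t.
Proof. by move=> t0; rewrite /flat t0 mulr_gt0 ?expR_gt0// exprn_gt0// invr_gt0. Qed.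

Lemma flat_eq0 k t : t <= 0 -> flat k t = 0.
Proof. by rewrite /flat leNgt => /negbTE ->. Qed.

Lemma flatS k t : flat k t = t * flat k.+1 t.
Proof.
rewrite /flat; case: ifP => [t0|_]; last by rewrite mulr0.
by rewrite mulrA exprS mulVKf// gt_eqF.
Qed.

(** Raising the index by one releases a factor [t]; what remains is bounded because exp(s) dominates
    s^(k+1)/(k+1)! at s = 1/t. *)
Lemma flat_le k t : 0 <= t -> flat k t <= t * k.+1`!%:R.
Proof.
rewrite le_eqVlt => /predU1P[<-|t0]; first by rewrite flat_eq0// mul0r.
rewrite flatS ler_wpM2l ?(ltW t0)// /flat t0 expRN ler_pdivrMr ?expR_gt0//.
have /expR_ge1Dxn H : 0 <= t^-1 by rewrite invr_ge0 ltW.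
have fact0 : (0 : R) < k.+1`!%:R by rewrite ltr0n fact_gt0.
rewrite mulrC -ler_pdivrMr// (le_trans _ (H k))// lerDr ler01 //.
Qed.

Lemma flat_cvg0 k : flat k t @[t --> (0 : R)] --> (0 : R).
Proof.
have c0 : `|t| * k.+1`!%:R @[t --> (0 : R)] --> (0 : R).
  rewrite -[X in _ --> X](mul0r (k.+1`!%:R)) -{2}(normr0 R).
  by apply: cvgM; [apply: cvg_norm; exact: cvg_id|exact: cvg_cst].
apply: (squeeze_cvgr _ (cvg_cst 0) c0).
apply: nearW => t; rewrite flat_ge0 /=; have [t0|t0] := leP 0 t.
  by rewrite ger0_norm// flat_le.
by rewrite flat_eq0 ?(ltW t0)// mulr_ge0.
Qed.

Lemma is_derive_flat k t :
  is_derive t 1 (flat k) (flat k.+2 t - k%:R * flat k.+1 t).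
Proof.
have [t0|t0|->] := ltgtP t 0.
- rewrite !flat_eq0 ?(ltW t0)// mulr0 subr0.
  apply: near_eq_is_derive (is_derive_cst 0 t 1).
  near=> s; rewrite flat_eq0//; apply/ltW; near: s; exact: lt_nbhsl.
- have E : {near t, (fun s : R => s^-1 ^+ k * expR (- s^-1)) =1 flat k}.
    near=> s; rewrite /flat ifT//; near: s; exact: lt_nbhsr.
  apply: near_eq_is_derive E _.
  have t0' := gt_eqF t0.
  have dV : is_derive t 1 (fun s : R => s^-1) (- t^-1 ^+ 2).
    apply: is_derive_eq; first by apply: is_deriveV; rewrite t0'.
    by rewrite /GRing.scale /= mulr1 exprVn.
  have dE : is_derive t 1 (fun s : R => expR (- s^-1)) (expR (- t^-1) * t^-1 ^+ 2).
    apply: (@is_derive1_comp _ expR (fun s => - s^-1)).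
    by have := is_deriveN dV; rewrite opprK.
  have dX := @is_deriveX _ _ _ k _ _ _ dV.
  rewrite (_ : (fun s => _) =
      (fun s : R => s^-1) ^+ k * (fun s : R => expR (- s^-1))); last first.
    by apply/funext => s; rewrite exprfctE.
  have H := is_deriveM dX dE; apply: (is_derive_eq H).
  rewrite /flat t0 !exprfctE /GRing.scale /=.
  by case: k {dX H} => [|k]; rewrite ?mul0r /= !exprS; ring.
rewrite !flat_eq0// mulr0 subr0.
(* By [flatS] the difference quotient at 0 is [flat k.+1] itself. *)
have L : h^-1 *: ((flat k \o shift 0) (h *: (1 : R)) - flat k 0) @[h --> 0^'] --> (0 : R).
  have : flat k.+1 t @[t --> (0 : R)^'] --> (0 : R).
    by apply: cvg_within_filter; exact: flat_cvg0.
  apply: cvg_trans; apply: near_eq_cvg; near=> h.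
  rewrite /= addr0 [h *: _]mulr1 [flat k 0]flat_eq0// subr0 [flat k h]flatS.
  rewrite /GRing.scale /= mulKf//; near: h; exact: nbhs_dnbhs_neq.
by split; [apply/cvg_ex; eexists; exact: L|exact/cvg_lim].
Unshelve. all: by end_near. Qed.

Lemma is_derive_scalar_comp (V : normedModType R) (F : R -> R) (f : V -> R)
    (x v : V) (a : R) :
  is_derive (f x) 1 F a -> derivable f x v ->
  is_derive x v (F \o f) (a * 'D_v f x).
Proof.
move=> dF df.
have := @line_is_derive _ _ f x v 0; rewrite scale0r add0r => /(_ df) dl.
have dFl : is_derive ((fun t => f (t *: v + x)) 0) 1 F a by rewrite scale0r add0r.
have [H1 H2] := is_derive1_comp dFl dl.
split; first by apply/(@derivable1P _ _ _ (F \o f)); exact: H1.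
rewrite -H2 /derive; set g1 := fun h => h^-1 *: _; set g2 := fun h => h^-1 *: _.
suff -> : g1 = g2 by []; apply/funext => h; rewrite /g1 /g2 /=.
by rewrite addr0 scale0r add0r [_%:A]mulr1.
Qed.

Lemma Ck_on_flat m n k (U : set 'rV[R]_m) (f : 'rV[R]_m -> R) : open U ->
  Ck_on n U f -> Ck_on n U (flat k \o f).
Proof.
move=> oU; elim: n k => [|n IHn] k Cf.
all: have cff x : U x -> {for x, continuous (flat k \o f)} by
  move=> Ux; apply: continuous_comp; [exact (Ck_on_cont Cf Ux)|];
  apply: differentiable_continuous; apply/derivable1_diffP;
  exact: (@ex_derive _ _ _ _ _ _ _ (is_derive_flat k (f x))).
  by split.
split=> // i.
have D x : U x -> is_derive x (delta_mx 0 i) (flat k \o f)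
   ((flat k.+2 (f x) - k%:R * flat k.+1 (f x)) * 'D_(delta_mx 0 i) f x).
  move=> Ux; apply: is_derive_scalar_comp; last exact: Ck_on_derivable Cf Ux.
  exact: is_derive_flat.
split; first by move=> x /D [].
have C1 := IHn k.+1 (Ck_onW Cf); have C2 := IHn k.+2 (Ck_onW Cf).
apply: (Ck_on_eq oU _ (Ck_on_mul oU (Ck_on_add oU C2
  (Ck_on_mul oU (Ck_on_cst n (- k%:R) oU) C1)) (Ck_on_derive i Cf))) => x Ux.
by have [_ ->] := D x Ux; rewrite /= mulNr.
Qed.

End flat_function.

Section bump.
Variables (R : realType) (m : nat) (p : 'rV[R]_m) (r : R).

(** A product over the coordinates because balls are cubes; the squares replace absolute values to
    keep each factor smooth. *)
Definition bump (x : 'rV[R]_m) : R :=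
  \prod_j flat 0 (r ^+ 2 - (x 0 j - p 0 j) ^+ 2).

Lemma Ck_on_bump k (U : set 'rV[R]_m) : open U -> Ck_on k U bump.
Proof.
move=> oU; apply: Ck_on_prod => // j.
pose q (x : 'rV[R]_m) : R := r ^+ 2 - (x 0 j - p 0 j) ^+ 2.
suff Cq : Ck_on k U q by exact: (Ck_on_flat 0 oU Cq).
have C1 := Ck_on_add oU (Ck_on_coord k j oU) (Ck_on_cst k (- p 0 j) oU).
have C2 := Ck_on_mul oU (Ck_on_cst k (-1) oU) (Ck_on_mul oU C1 C1).
apply: (Ck_on_eq oU _ (Ck_on_add oU (Ck_on_cst k (r ^+ 2) oU) C2)) => x _ /=.
by rewrite /q /cst expr2 mulN1r.
Qed.

Lemma bump_gt0 x : 0 < r -> ball p r x -> 0 < bump x.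
Proof.
move=> r0 /(ball_rVP _ _ r0) h; apply: prodr_gt0 => j _; apply: flat_gt0.
by rewrite subr_gt0 -real_normK ?num_real// ltrXn2r// ?nnegrE 1?ltW// distrC h.
Qed.

Lemma bump_eq0 x : 0 < r -> ~ ball p r x -> bump x = 0.
Proof.
move=> r0 /(ball_rVP _ _ r0)/existsNP[j /negP]; rewrite -leNgt => h.
rewrite /bump (bigD1 j)//= flat_eq0 ?mul0r// subr_le0.
by rewrite -[leRHS]real_normK ?num_real// lerXn2r// ?nnegrE// ?(ltW r0)// distrC.
Qed.

End bump.

(** * Averages along segments and Hadamard's lemma *)

Section segment_averages.
Variables (R : realType) (m : nat) (p : 'rV[R]_m) (r : R).
Hypothesis r0 : 0 < r.
Implicit Types (x y : 'rV[R]_m) (F : 'rV[R]_m -> R) (t : R) (k : nat).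

Let B := ball p r.
Let mu := @lebesgue_measure R.
Let I01 : set R := `[0, 1]%classic.

Let mI01 : measurable (I01 : set (measurableTypeR R)).
Proof. exact: measurable_itv. Qed.

Let mu01 : fine (mu I01) = 1.
Proof. by rewrite /mu /I01 lebesgue_measure_itv/= lte_fin ltr01 oppr0 adde0. Qed.

Let icst (c : R) : mu.-integrable I01 (EFin \o cst c).
Proof.
apply: continuous_compact_integrable; first exact: segment_compact.
by apply: continuous_in_subspaceT => t _; exact: cvg_cst.
Qed.

Let openB : open B. Proof. exact: ball_open. Qed.

Lemma segment_ball x t : ball p r x -> I01 t -> ball p r (t *: (x - p) + p).
Proof.
move=> /(ball_rVP _ _ r0) xP; rewrite /I01/= in_itv/= => /andP[t0 t1].
apply/(ball_rVP _ _ r0) => j; rewrite !mxE.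
rewrite opprD addrCA subrr addr0 normrN normrM (ger0_norm t0).
apply: le_lt_trans (xP j); rewrite distrC.
by rewrite -[leRHS]mul1r ler_wpM2r.
Qed.

(** Each differentiation in [x] brings out a factor [t] from the inner map; the weight [t ^+ k]
    records these factors, so that derivatives of averages are again averages of this kind. *)
Definition radial k F x t : R := t ^+ k * F (t *: (x - p) + p).

Definition radial_avg k F x : R := \int[mu]_(t in I01) radial k F x t.

Let cB F := forall x, B x -> {for x, continuous F}.

Lemma radial_continuous2 k F x t : cB F -> B x -> I01 t ->
  radial k F u.2 u.1 @[u --> (t, x)] --> radial k F x t.
Proof.
move=> cF Bx It; apply: cvgM.
  have E : u.1 @[u --> (t, x)] --> t by exact: cvg_fst.
  elim: k => [|k IHk]; first exact: cvg_cst.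
  under eq_fun do rewrite exprS.
  by rewrite exprS; exact: cvgM.
have G : (u.1 *: (u.2 - p) + p) @[u --> (t, x)] --> t *: (x - p) + p.
  apply: cvgD; last exact: cvg_cst.
  apply: cvgZ; first exact: cvg_fst.
  by apply: cvgB; [exact: cvg_snd|exact: cvg_cst].
exact: (cvg_comp _ _ G (cF _ (segment_ball Bx It))).
Qed.

Lemma radial_continuous k F x t : cB F -> B x -> I01 t ->
  {for t, continuous (radial k F x)}.
Proof.
move=> cF Bx It.
have H : (u, x) @[u --> t] --> (t, x).
  exact: (@cvg_pair _ _ _ _ _ _ _ _ _ id (cst x) cvg_id (cvg_cst x)).
exact: (cvg_comp _ _ H (radial_continuous2 cF Bx It)).
Qed.

(** Compactness of the unit interval turns joint continuity in [t] and [x] into continuity in [x]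
    that is uniform in [t]. *)
Lemma radial_uniform k F x (e : R) : cB F -> B x -> 0 < e ->
  \forall y \near x, forall t, I01 t -> `|radial k F y t - radial k F x t| < e.
Proof.
move=> cF Bx e0.
have /compact_near_coveringP cov := @segment_compact R 0 1.
apply: (cov _ (nbhs x) (fun y t => `|radial k F y t - radial k F x t| < e)).
move=> t It.
have e20 : 0 < e / 2 by rewrite divr_gt0.
have /cvgrPdist_lt/(_ _ e20) H2 := radial_continuous2 (k := k) cF Bx It.
have /cvgrPdist_lt/(_ _ e20) H1 := radial_continuous (k := k) cF Bx It.
have H3 : \forall u \near (t, x), `|radial k F x t - radial k F x u.1| < e / 2.
  exact: (cvg_fst (F := nbhs t) (G := nbhs x) H1).
near=> u; rewrite (splitr e).
rewrite -(subrKA (radial k F x t)) (le_lt_trans (ler_normD _ _))// ltrD//.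
  by rewrite distrC; near: u; exact: H2.
by near: u; exact: H3.
Unshelve. all: by end_near. Qed.

Lemma radial_integrable k F x : cB F -> B x ->
  mu.-integrable I01 (EFin \o radial k F x).
Proof.
move=> cF Bx; apply: continuous_compact_integrable.
  exact: segment_compact.
by apply: continuous_in_subspaceT => t /set_mem It; exact: radial_continuous.
Qed.

Let Rintegral_lincomb (I : Type) (s : seq I) (c : I -> R) (f : I -> R -> R) :
  (forall i, mu.-integrable I01 (EFin \o f i)) ->
  \int[mu]_(t in I01) (\sum_(i <- s) c i * f i t) =
  \sum_(i <- s) c i * \int[mu]_(t in I01) f i t.
Proof.
move=> fi.
have ci i : mu.-integrable I01 (EFin \o (fun t => c i * f i t)).
  by have := integrableZl mI01 (c i) (fi i); apply: eq_integrable.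
(* Integrability of the partial sums is proved along with the formula, since additivity of the
   integral asks for it at each step. *)
suff [//] : \int[mu]_(t in I01) (\sum_(i <- s) c i * f i t) =
    \sum_(i <- s) c i * \int[mu]_(t in I01) f i t /\
  mu.-integrable I01 (EFin \o (fun t => \sum_(i <- s) c i * f i t)).
elim: s => [|i s [IH1 IH2]].
  have E : (fun t : R => \sum_(i <- [::]) c i * f i t) = cst 0.
    by apply/funext => t; rewrite big_nil.
  by rewrite E big_nil Rintegral_cst// mul0r.
have E : (fun t : R => \sum_(j <- i :: s) c j * f j t) =
    (fun t => c i * f i t + \sum_(j <- s) c j * f j t).
  by apply/funext => t; rewrite big_cons.
rewrite E big_cons; split; last first.
  by have := integrableD mI01 (ci i) IH2; apply: eq_integrable.
by rewrite (RintegralD mI01 (ci i) IH2) (RintegralZl _ mI01 (fi i)) IH1.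
Qed.

Lemma radial_avg_continuous k F x : cB F -> B x ->
  {for x, continuous (radial_avg k F)}.
Proof.
move=> cF Bx; apply/(@cvgrPdist_le _ _ _ _ (nbhs_filter x)) => e e0.
have Bn : \forall y \near x, B y by exact: open_nbhs_nbhs (conj openB Bx).
have Un := radial_uniform k cF Bx e0; near=> y.
have By : B y by near: y; exact: Bn.
have yP : forall t, I01 t -> `|radial k F y t - radial k F x t| < e.
  by near: y; exact: Un.
rewrite /radial_avg -RintegralB//; try exact: radial_integrable.
have iB : mu.-integrable I01 (EFin \o (radial k F x \- radial k F y)).
  have := integrableB mI01 (radial_integrable k cF Bx)
    (radial_integrable k cF By).
  by apply: eq_integrable.
apply: le_trans (le_normr_Rintegral _ iB) _ => //.
have -> : e = \int[mu]_(t in I01) (cst e) t.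
  by rewrite Rintegral_cst// mu01 mulr1.
apply: le_Rintegral; first exact: mI01.
- exact: integrable_abse iB.
- exact: icst.
- by move=> t It /=; rewrite distrC ltW// yP.
Unshelve. all: by end_near. Qed.

Lemma radial_avg_derive k F x i : Ck_on 1 B F -> B x ->
  is_derive x (delta_mx 0 i) (radial_avg k F)
    (radial_avg k.+1 ('D_(delta_mx 0 i) F) x).
Proof.
move=> CF Bx.
set v : 'rV[R]_m := delta_mx 0 i.
have cF : cB F by move=> y By; exact (Ck_on_cont CF By).
have cDF : cB ('D_v F) by move=> y By; exact (Ck_on_cont (Ck_on_derive i CF) By).
pose f (s t : R) := radial k F (s *: v + x) t.
pose df (s t : R) := radial k.+1 ('D_v F) (s *: v + x) t.
have dP s t : B (s *: v + x) -> I01 t ->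
    is_derive s 1 (f ^~ t) (df s t).
  move=> Bs It; set z := t *: (x - p) + p.
  have zE u : t *: (u *: v + x - p) + p = (t * u) *: v + z.
    by rewrite /z -addrA scalerDr scalerA addrA.
  have dl : is_derive (t * s) 1 (fun u => F (u *: v + z))
      ('D_v F ((t * s) *: v + z)).
    apply: line_is_derive; apply: Ck_on_derivable CF _; rewrite -zE.
    exact: segment_ball.
  have dt : is_derive s 1 (fun u => t * u) t.
    have := is_deriveZ t (is_derive_id s (1 : R)).
    by move=> H; apply: is_derive_eq H _; rewrite /GRing.scale /= mulr1.
  have dc := @is_derive1_comp _ (fun u => F (u *: v + z)) (fun u => t * u) s _ _ dl dt.
  have := is_deriveZ (t ^+ k) dc.
  have -> : t ^+ k \*: ((fun u => F (u *: v + z)) \o (fun u => t * u)) = f ^~ t.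
    by apply/funext => u; rewrite /f /radial zE.
  move=> H; apply: is_derive_eq H _.
  by rewrite /df /radial zE /GRing.scale /= exprS; ring.
have Bx1 : \forall y \near x, B y /\ forall t, I01 t ->
    `|radial k.+1 ('D_v F) y t - radial k.+1 ('D_v F) x t| < 1.
  apply: filterI; last exact: radial_uniform.
  exact: open_nbhs_nbhs (conj openB Bx).
have /nbhs_ballP[d /= d0 dB] := Bx1.
have dball s : `]-d, d[%classic s -> ball x d (s *: v + x).
  rewrite /= in_itv/= -ltr_norml => sd; apply/ball_rVP => // j.
  rewrite !mxE eqxx /= opprD addrCA subrr addr0 normrN normrM.
  apply: le_lt_trans sd; rewrite -[leRHS]mulr1 ler_wpM2l//.
  by case: (_ == _); rewrite ?normr1 ?normr0.
(* A majorant independent of [s]: on the chosen neighbourhood the derivative differs from its value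
   at [x] by less than 1, uniformly in [t]. *)
pose G t := `|radial k.+1 ('D_v F) x t| + 1.
have G0 t : 0 <= G t by rewrite addr_ge0.
have iG : mu.-integrable I01 (EFin \o G).
  have i1 := integrable_abse (radial_integrable k.+1 cDF Bx).
  have := integrableD mI01 i1 (icst 1).
  by apply: eq_integrable.
have I0 : `]-d, d[%classic (0 : R) by rewrite /= in_itv /= oppr_lt0 d0.
have intf s : `]-d, d[%classic s -> mu.-integrable I01 (EFin \o f s).
  by move=> /dball/dB[Bs _]; exact: radial_integrable.
have der s t : `]-d, d[%classic s -> I01 t -> derivable (f ^~ t) s 1.
  by move=> /dball/dB[Bs _] It; have [] := dP s t Bs It.
have p1E s t : B (s *: v + x) -> I01 t -> partial1of2 f s t = df s t.
  by move=> Bs It; rewrite partial1of2E; have [_ ->] := dP s t Bs It.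
have Gub s t : `]-d, d[%classic s -> I01 t -> `|partial1of2 f s t| <= G t.
  move=> /dball/dB[Bs /= H] It; rewrite p1E// /G.
  have := lerB_dist (df s t) (radial k.+1 ('D_v F) x t).
  by have := H t It; rewrite -/(df s t); lra.
have D1 := derivable_under_integral mI01 I0 intf der G0 iG Gub.
have D2 := differentiation_under_integral mI01 I0 intf der G0 iG Gub.
have fE : (fun s => \int[mu]_(t in I01) f s t) =
   (fun s => radial_avg k F (s *: v + x)) by [].
have dval : 'D_v (radial_avg k F) x = 
    'D_(1 : R) (fun s : R => radial_avg k F (s *: v + x)) (0 : R).
  rewrite /derive; set g1 := fun h => h^-1 *: _; set g2 := fun h => h^-1 *: _.
  suff -> : g1 = g2 by []; apply/funext => h; rewrite /g1 /g2 /=.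
  by rewrite addr0 scale0r add0r [_%:A]mulr1.
split; first exact/derivable1P.
rewrite dval -derive1E -fE D2 /radial_avg.
apply: eq_Rintegral => t /set_mem It.
by rewrite p1E /df ?scale0r ?add0r.
Qed.

Lemma Ck_on_radial_avg n k F : Ck_on n B F -> Ck_on n B (radial_avg k F).
Proof.
elim: n k F => [|n IHn] k F CF.
  by split=> // x Bx; apply: radial_avg_continuous => // y By; exact (Ck_on_cont CF By).
have CF1 : Ck_on 1 B F.
  elim: n {IHn} CF => // n IHn CF; apply: IHn; exact: Ck_onW.
split.
  by move=> x Bx; apply: radial_avg_continuous => // y By; exact (Ck_on_cont CF By).
move=> i; split; first by move=> x /(radial_avg_derive k i CF1) [].
apply: (Ck_on_eq openB _ (IHn k.+1 _ (Ck_on_derive i CF))) => x Bx.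
by have [_ ->] := radial_avg_derive k i CF1 Bx.
Qed.

(** The fundamental theorem of calculus along the segment from [p] to [x] gives [h i] as the average
    of the i-th partial derivative over that segment. At [p] the integrand is constant. *)
Lemma hadamard F : smooth_on B F -> exists h : 'I_m -> 'rV[R]_m -> R,
  [/\ forall i, smooth_on B (h i),
      forall i, h i p = 'D_(delta_mx 0 i) F p &
      forall x, B x -> F x = F p + \sum_i (x 0 i - p 0 i) * h i x].
Proof.
move=> CF; exists (fun i => radial_avg 0 ('D_(delta_mx 0 i) F)); split.
- move=> i n; apply: Ck_on_radial_avg; exact: Ck_on_derive (CF n.+1).
- move=> i; rewrite /radial_avg.
  under eq_Rintegral do rewrite /radial subrr scaler0 add0r expr0 mul1r.
  by rewrite Rintegral_cst// mu01 mulr1.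
move=> x Bx; apply/eqP; rewrite addrC -subr_eq; apply/eqP.
have cD i : cB ('D_(delta_mx 0 i) F).
  by move=> y By; exact (Ck_on_cont (Ck_on_derive i (CF 1%N)) By).
pose G (t : R) := t *: (x - p) + p.
pose dFG t := \sum_i (x 0 i - p 0 i) * radial 0 ('D_(delta_mx 0 i) F) x t.
have BG t : I01 t -> B (G t) by exact: segment_ball.
have dG t : I01 t -> is_derive t 1 (F \o G) (dFG t).
  move=> It.
  have dGj j : is_derive t 1 (fun u => G u 0 j) (x 0 j - p 0 j).
    have H := is_deriveD (is_deriveZ (x 0 j - p 0 j) (is_derive_id t (1 : R)))
       (is_derive_cst (p 0 j) t (1 : R)).
    have -> : (fun u => G u 0 j) = (x 0 j - p 0 j) \*: id + cst (p 0 j).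
      by apply/funext => u; rewrite !mxE mulrC.
    by apply: is_derive_eq H _; rewrite /GRing.scale /= addr0 mulr1.
  have := @chain_rule _ _ _ F G t 1.
  case.
  - apply: filterS (open_nbhs_nbhs (conj openB (BG t It))) => y By j.
    exact: Ck_on_derivable (CF 1%N) By.
  - by move=> j; exact: cD (BG t It).
  - by move=> j; have [] := dGj j.
  move=> H1 H2; split => //; rewrite H2 /dFG; apply: eq_bigr => j _.
  by have [_ ->] := dGj j; rewrite /radial expr0 mul1r.
have cFG t : I01 t -> {for t, continuous (F \o G)}.
  move=> /dG [? _]; apply: differentiable_continuous; exact/derivable1_diffP.
have cdFG t : I01 t -> {for t, continuous dFG}.
  move=> It; apply: (cvg_big add_continuous) => j _; apply: cvgM; first exact: cvg_cst.
  by exact (radial_continuous (cD j) Bx It).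
have i01 : {subset `]0, 1[ <= `[(0 : R), 1]} by exact: subset_itv_oo_cc.
have FTC := @continuous_FTC2 R dFG (F \o G) 0 1 ltr01.
have h1 : {within `[0, 1], continuous dFG}.
  by apply: continuous_in_subspaceT => t /set_mem; exact: cdFG.
have h2 : derivable_oo_LRcontinuous (F \o G) 0 1.
  split.
  - by move=> t /i01 /dG [].
  - by apply: cvg_at_right_filter; apply: cFG; rewrite /I01 /= in_itv /= lexx ler01.
  - by apply: cvg_at_left_filter; apply: cFG; rewrite /I01 /= in_itv /= lexx ler01.
have h3 : {in `]0, 1[, (F \o G)^`()%classic =1 dFG}.
  by move=> t /i01 It; rewrite derive1E; have [_ ->] := dG t It.
have := FTC h1 h2 h3; rewrite /= /G scale1r scale0r add0r subrK.
move=> /(congr1 fine) /= <-.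
transitivity (\int[mu]_(t in I01) dFG t) => //.
by rewrite Rintegral_lincomb// => i; exact: radial_integrable.
Qed.

End segment_averages.

(** * Bump functions, coordinate frames and Riesz representation *)

Lemma open_preimage_within (T U : topologicalType) (f : T -> U) (A : set T)
    (O : set U) :
  open A -> {within A, continuous f} -> open O -> open (A `&` f @^-1` O).
Proof.
move=> oA; rewrite continuous_open_subspace// => cf oO.
rewrite openE => x [Ax Ofx]; apply: filterI.
  exact: open_nbhs_nbhs.
by apply: (cf x (mem_set Ax)); exact: open_nbhs_nbhs.
Qed.

Section smooth_functions_on_manifolds.
Variables (R : realType) (m : nat) (M : manifold R m).
Implicit Types (c d : chart R m M) (p q : M).

(** One chart around each point is enough: transition maps are smooth and [Ck_on_comp] carries
    smoothness over to the other charts of the atlas. *)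
Lemma smooth_local (f : M -> R) :
  (forall p, exists c (W : set 'rV[R]_m),
    [/\ atlas c, chart_dom c p, open W, W (c p) & W `<=` chart_cod c /\
        smooth_on W (f \o chart_inv c)]) ->
  f \in @smooth R m M.
Proof.
move=> H; rewrite inE => d Md k; apply: Ck_on_local => x dx.
have [c [W [Mc cp oW Wp [Wc CW]]]] := H (chart_inv d x).
pose O := chart_dom c `&` c @^-1` W.
have oO : open O.
  by apply: open_preimage_within => //; [exact: chart_dom_open|exact: chart_fun_cont].
pose U := chart_cod d `&` chart_inv d @^-1` O.
have oU : open U.
  by apply: open_preimage_within => //; [exact: chart_cod_open|exact: chart_inv_cont].
exists U; split=> //.
have CG j : Ck_on k U (fun y => c (chart_inv d y) 0 j).
  apply: Ck_on_subset (atlas_compatible Md Mc j k).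
  by move=> y [dy [cy _]].
have UW y : U y -> W (c (chart_inv d y)) by move=> [_ []].
apply: (Ck_on_eq oU _ (Ck_on_comp (G := fun y => c (chart_inv d y))
   oU oW UW CG (CW k))).
by move=> y [_ [cy _]] /=; rewrite chart_funK.
Qed.

Definition chart_extend c (u : 'rV[R]_m -> R) : M -> R :=
  fun q => if `[<chart_dom c q>] then u (c q) else 0.

(** This is where the Hausdorff property enters: the image of the compact set [K] in the manifold is
    closed, so the extension vanishes on an open neighbourhood of every point outside it. *)
Lemma chart_extend_smooth c (K V : set 'rV[R]_m) (u : 'rV[R]_m -> R) :
  atlas c -> compact K -> K `<=` V -> open V -> V `<=` chart_cod c ->
  smooth_on V u -> (forall x, ~ K x -> u x = 0) ->
  chart_extend c u \in @smooth R m M.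
Proof.
move=> Mc cK KV oV Vc Cu u0; apply: smooth_local => q.
have Kc : K `<=` chart_cod c by move=> x /KV/Vc.
have [[x Kx <-]|nKq] := pselect ((chart_inv c @` K) q).
  exists c, V; split=> //; first exact/chart_invP/Kc.
    by rewrite chart_invK; [exact: KV|exact: Kc].
  split=> // k; apply: (Ck_on_eq oV _ (Cu k)) => y Vy.
  rewrite /= /chart_extend asboolT ?chart_invK//; try exact: Vc.
  by apply: chart_invP; exact: Vc.
have [d Md dq] := atlas_cover q.
pose O := ~` (chart_inv c @` K).
have oO : open O.
  rewrite openC; apply: compact_closed; first exact: manifold_hausdorff.
  apply: continuous_compact => //.
  by apply: continuous_subspaceW Kc _; exact: chart_inv_cont.
pose W := chart_cod d `&` chart_inv d @^-1` O.
have oW : open W.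
  by apply: open_preimage_within => //; [exact: chart_cod_open|exact: chart_inv_cont].
exists d, W; split=> //.
  by split; [exact: chart_funP|rewrite /= chart_funK].
split; first by move=> y [].
move=> k; apply: (Ck_on_eq oW _ (Ck_on_cst k 0 oW)) => y [_ Oy] /=.
rewrite /chart_extend; case: asboolP => // cy; rewrite u0// => Ky.
by apply: Oy; exists (c (chart_inv d y)) => //; rewrite chart_funK.
Qed.

End smooth_functions_on_manifolds.

(** * Coordinate cubes and cut-off coordinate fields *)

Section coordinate_boxes.
Variables (R : realType) (m : nat) (M : manifold R m).
Implicit Types (p q : M).

Definition closed_box (x : 'rV[R]_m) (r : R) : set 'rV[R]_m :=
  [set y | forall j, `|x 0 j - y 0 j| <= r].

Lemma closed_box_compact x r : compact (closed_box x r).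
Proof.
have := @rV_compact _ m (fun j => `[x 0 j - r, x 0 j + r]%classic)
  (fun j => @segment_compact R _ _).
congr compact; apply/seteqP; split=> y /= yP j; have := yP j;
  by rewrite in_itv/= distrC ler_distl.
Qed.

Lemma ball_closed_box x r y : ball x r y -> closed_box x r y.
Proof. by move=> [r0 yP] j; apply/ltW/(yP 0 j). Qed.

Lemma closed_box_subset (V : set 'rV[R]_m) x : open V -> V x ->
  exists2 r : R, 0 < r & closed_box x r `<=` V.
Proof.
move=> oV Vx; have /nbhs_ballP[e /= e0 eV] := open_nbhs_nbhs (conj oV Vx).
exists (e / 2); first by rewrite divr_gt0.
move=> y yP; apply/eV/ball_rVP => // j.
by rewrite (le_lt_trans (yP j))// ltr_pdivrMr// mulr_natr mulr2n ltrDl.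
Qed.

(* The open cube of radius [box_radius] about [box_center] in a chart, with
   [box_nbhs] an open neighbourhood of its closure. *)
Record box := Box {
  box_chart : chart R m M;
  box_center : 'rV[R]_m;
  box_radius : R;
  box_nbhs : set 'rV[R]_m;
  box_atlas : atlas box_chart;
  box_radius_gt0 : 0 < box_radius;
  box_open : open box_nbhs;
  box_nbhs_cod : box_nbhs `<=` chart_cod box_chart;
  box_closed : closed_box box_center box_radius `<=` box_nbhs }.

Definition in_box (b : box) p :=
  chart_dom (box_chart b) p /\
  ball (box_center b) (box_radius b) (box_chart b p).

Definition box_bump (b : box) := bump (box_center b) (box_radius b).

Fact box_fun_smooth (b : box) (u : 'rV[R]_m -> R) : smooth_on (box_nbhs b) u ->
  chart_extend (box_chart b) (fun x => box_bump b x * u x) \in @smooth R m M.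
Proof.
move=> Cu; apply: (chart_extend_smooth (box_atlas b)
  (@closed_box_compact (box_center b) (box_radius b)) (@box_closed b)
  (@box_open b) (@box_nbhs_cod b)).
  by move=> k; apply: Ck_on_mul; [exact: box_open|exact/Ck_on_bump/box_open|exact: Cu].
move=> x nx; rewrite /box_bump bump_eq0 ?mul0r//; first exact: box_radius_gt0.
by move=> /ball_closed_box.
Qed.

Definition box_fun (b : box) u (Cu : smooth_on (box_nbhs b) u) : smoothfun M :=
  SmoothFun (box_fun_smooth Cu).

Lemma box_fun_in (b : box) u (Cu : smooth_on (box_nbhs b) u) p : in_box b p ->
  box_fun Cu p = box_bump b (box_chart b p) * u (box_chart b p).
Proof. by move=> [cp _]; rewrite /= /chart_extend asboolT. Qed.

Lemma box_fun_out (b : box) u (Cu : smooth_on (box_nbhs b) u) p : ~ in_box b p ->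
  box_fun Cu p = 0.
Proof.
move=> nbp; rewrite /= /chart_extend; case: asboolP => // cp.
rewrite /box_bump bump_eq0 ?mul0r//; first exact: box_radius_gt0.
by move=> bp; apply: nbp.
Qed.

Lemma box_bump_gt0 (b : box) p : in_box b p -> 0 < box_bump b (box_chart b p).
Proof. by move=> [_ bp]; apply: bump_gt0 bp; exact: box_radius_gt0. Qed.

Lemma smoothfun_chart (f : smoothfun M) (c : chart R m M) : atlas c ->
  smooth_on (chart_cod c) (f \o chart_inv c).
Proof. by move=> Mc k; have := smoothfunP f; rewrite inE => /(_ c Mc k). Qed.

Lemma smoothfun_box (b : box) (f : smoothfun M) :
  smooth_on (box_nbhs b) (f \o chart_inv (box_chart b)).
Proof.
move=> k; apply: Ck_on_subset (@box_nbhs_cod b) _.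
exact: smoothfun_chart (box_atlas b) k.
Qed.

Fact box_partial_smooth (b : box) (f : smoothfun M) (i : 'I_m) :
  smooth_on (box_nbhs b) ('D_(delta_mx 0 i) (f \o chart_inv (box_chart b))).
Proof. by move=> k; exact: Ck_on_derive (smoothfun_box b f k.+1). Qed.

Definition box_field_fun (b : box) (i : 'I_m) (f : smoothfun M) : smoothfun M :=
  box_fun (box_partial_smooth b f i).

Lemma box_derivable (b : box) (f : smoothfun M) i p : in_box b p ->
  derivable (f \o chart_inv (box_chart b)) (box_chart b p) (delta_mx 0 i).
Proof.
move=> [_ /ball_closed_box/box_closed bp].
exact: Ck_on_derivable (smoothfun_box b f 1%N) bp.
Qed.

Fact box_field_linear b i : linear (box_field_fun b i).
Proof.
move=> a f h; apply/val_inj/funext => p.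
have [bp|nbp] := pselect (in_box b p); last first.
  transitivity (0 : R); first exact: box_fun_out.
  transitivity (a * box_field_fun b i f p + box_field_fun b i h p) => //.
  by rewrite !box_fun_out// mulr0 addr0.
transitivity (a * box_field_fun b i f p + box_field_fun b i h p) => //.
rewrite [LHS]box_fun_in// !box_fun_in//.
set z := box_chart b p; set v := delta_mx 0 i; set k := chart_inv _.
have -> : 'D_v ((a *: f + h : smoothfun M) \o k) z =
    a * 'D_v (f \o k) z + 'D_v (h \o k) z.
  rewrite -[a * _]/(a *: _) -deriveZ; last exact: box_derivable.
  rewrite -deriveD//; first exact/derivableZ/box_derivable.
  exact: box_derivable.
by rewrite mulrDr mulrCA.
Qed.

Fact box_field_leibniz b i : leibniz (box_field_fun b i).
Proof.
move=> f h; apply/val_inj/funext => p.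
transitivity (box_field_fun b i f p * h p + f p * box_field_fun b i h p) => //.
have [bp|nbp] := pselect (in_box b p); last first.
  by rewrite [LHS]box_fun_out// !box_fun_out// mulr0 mul0r addr0.
rewrite [LHS]box_fun_in// !box_fun_in//.
set z := box_chart b p; set v := delta_mx 0 i; set k := chart_inv _.
have kz : k z = p by rewrite /k /z chart_funK//; case: bp.
have -> : 'D_v ((f * h : smoothfun M) \o k) z =
    f p * 'D_v (h \o k) z + h p * 'D_v (f \o k) z.
  rewrite -[in f p]kz -[in h p]kz.
  by apply: (@deriveM _ _ (f \o k) (h \o k)); exact: box_derivable.
ring.
Qed.

Definition box_field b i : vfield M :=
  VField (@box_field_linear b i) (@box_field_leibniz b i).

End coordinate_boxes.

(** * Expansion of a vector field in a cut-off coordinate frame *)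

Section box_frames.
Variables (R : realType) (m : nat) (M : manifold R m).
Implicit Types (p q : M) (f : smoothfun M) (Y : vfield M) (b : box M).

Lemma smoothfun_sumE (I : Type) (s : seq I) (u : I -> smoothfun M) p :
  (\sum_(i <- s) u i) p = \sum_(i <- s) u i p.
Proof. by elim/big_rec2: _ => // i x y _ <-. Qed.

Lemma smoothfun_prodE (I : Type) (s : seq I) (u : I -> smoothfun M) p :
  (\prod_(i <- s) u i) p = \prod_(i <- s) u i p.
Proof. by elim/big_rec2: _ => // i x y _ <-. Qed.

Lemma vfield_sumE (I : Type) (s : seq I) (X : I -> vfield M) f :
  (\sum_(i <- s) X i) f = \sum_(i <- s) X i f.
Proof. by elim/big_rec2: _ => // i x y _ <-. Qed.

Fact smooth_on_one b : smooth_on (box_nbhs b) (cst 1).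
Proof. by move=> k; apply/Ck_on_cst/box_open. Qed.

Fact smooth_on_coord b j : smooth_on (box_nbhs b) (fun x => x 0 j).
Proof. by move=> k; apply/Ck_on_coord/box_open. Qed.

Definition box_psi b : smoothfun M := box_fun (@smooth_on_one b).

Definition box_coord b j : smoothfun M := box_fun (@smooth_on_coord b j).

(** Inside the box this is psi^2 times [Y] of the i-th coordinate, obtained by the quotient rule
    from the global functions psi x_i and psi. The factor psi contained in [box_field] raises the
    exponent to 3 in the frame expansion. *)
Definition box_coef b Y i : smoothfun M :=
  box_psi b * Y (box_coord b i) - box_coord b i * Y (box_psi b).

Lemma box_psi_gt0 b p : in_box b p -> 0 < box_psi b p.
Proof. by move=> bp; rewrite box_fun_in// mulr1; exact: box_bump_gt0. Qed.

Lemma box_psi_eq0 b p : ~ in_box b p -> box_psi b p = 0.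
Proof. exact: box_fun_out. Qed.

Lemma box_coord_in b j p : in_box b p ->
  box_coord b j p = box_psi b p * box_chart b p 0 j.
Proof. by move=> bp; rewrite !box_fun_in// mulr1. Qed.

Lemma box_exists p (c : chart R m M) (V : set 'rV[R]_m) : atlas c ->
  chart_dom c p -> open V -> V `<=` chart_cod c -> V (c p) ->
  exists b : box M, [/\ box_chart b = c, in_box b p, box_center b = c p &
    box_nbhs b = V].
Proof.
move=> Mc cp oV Vc Vp; have [r r0 rV] := closed_box_subset oV Vp.
exists (Box Mc r0 oV Vc rV); split=> //; split=> //=.
exact: ballxx.
Qed.

Lemma vfieldD Y f h : Y (f + h) = Y f + Y h.
Proof. exact: linearD. Qed.

Lemma vfieldB Y f h : Y (f - h) = Y f - Y h.
Proof. exact: linearB. Qed.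

Lemma vfieldZ Y (a : R) f : Y (a *: f) = a *: Y f.
Proof. exact: linearZ. Qed.

Lemma vfield_mul_at Y f h p : Y (f * h) p = Y f p * h p + f p * Y h p.
Proof. by rewrite vfield_leibniz. Qed.

(* Multiplying the Hadamard expansion of [f] at [q] by the square of a bump
   function around [q] makes it global, so that [Y] can be applied to it. *)
Lemma box_expansion b Y f q : in_box b q ->
  box_psi b q ^+ 3 * Y f q = \sum_i box_coef b Y i q * box_field b i f q.
Proof.
move=> bq; have [cq xq] := bq.
set c := box_chart b in cq xq *; set x := c q in xq *.
pose F := f \o chart_inv c.
have oB : open (chart_cod c) by exact: chart_cod_open.
have cx : chart_cod c x by exact: chart_funP.
have /nbhs_ballP[s s0' sB] := open_nbhs_nbhs (conj oB cx).
have s0 : 0 < s := s0'.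
have Fsm : smooth_on (ball x s) F.
  by move=> k; apply: Ck_on_subset sB _; exact: smoothfun_chart (box_atlas b) k.
have [h [hsm hx hE]] := hadamard s0 Fsm.
have [b' [b'c b'q b'x b'V]] := box_exists (box_atlas b) cq (ball_open x s) sB
  (ballxx _ s0).
have hsm' i : smooth_on (box_nbhs b') (h i) by rewrite b'V; exact: hsm.
have xsm i : smooth_on (box_nbhs b') (fun y => y 0 i - x 0 i).
  move=> k; have ob' := @box_open _ _ _ b'.
  exact: (Ck_on_add ob' (Ck_on_coord k i ob') (Ck_on_cst k (- x 0 i) ob')).
pose rho := box_psi b'.
have rho0 : 0 < rho q by exact: box_psi_gt0.
have psi0 : 0 < box_psi b q by exact: box_psi_gt0.
have bcx i : box_coord b i q = box_psi b q * x 0 i by exact: box_coord_in.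
have xi0 i : box_fun (xsm i) q = 0 by rewrite box_fun_in// b'c subrr mulr0.
have hi0 i : box_fun (hsm' i) q = rho q * 'D_(delta_mx 0 i) F x.
  by rewrite box_fun_in// /rho box_fun_in// mulr1 b'c -/x hx.
have E1 : rho * rho * f = f q *: (rho * rho) +
    \sum_i box_fun (xsm i) * box_fun (hsm' i).
  apply/val_inj/funext => z.
  transitivity (rho z * rho z * f z) => //.
  transitivity (f q * (rho z * rho z) +
      \sum_i box_fun (xsm i) z * box_fun (hsm' i) z); last first.
    by rewrite -(smoothfun_sumE _ (fun i => box_fun (xsm i) * box_fun (hsm' i))).
  have [b'z|nb'z] := pselect (in_box b' z); last first.
    rewrite /rho box_psi_eq0// !mul0r mulr0 add0r big1// => i _.
    by rewrite box_fun_out ?mul0r.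
  have fz : f z = f q + \sum_i (c z 0 i - x 0 i) * h i (c z).
    have [cz /ball_closed_box/box_closed] := b'z.
    rewrite b'V b'c in cz * => /hE.
    by rewrite /F /= (chart_funK cz) (chart_funK cq).
  rewrite fz mulrDr [_ * f q]mulrC; congr (_ + _).
  rewrite mulr_sumr; apply: eq_bigr => i _.
  by rewrite /rho !box_fun_in// b'c /cst /= -/c; ring.
(* Writing one product of both cut-offs in two ways expresses [Y] of the coordinate cut off near [q]
   through [box_coef b Y i], whose bump function does not depend on [q]. *)
have E2 i : box_psi b * box_fun (xsm i) =
    rho * box_coord b i - x 0 i *: (rho * box_psi b).
  apply/val_inj/funext => z.
  transitivity (box_psi b z * box_fun (xsm i) z) => //.
  transitivity (rho z * box_coord b i z - x 0 i * (rho z * box_psi b z)) => //.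
  have [b'z|nb'z] := pselect (in_box b' z); last first.
    by rewrite /rho [box_psi b' z]box_psi_eq0// [box_fun (xsm i) z]box_fun_out//; ring.
  have [bz|nbz] := pselect (in_box b z); last first.
    by rewrite [box_psi b z]box_psi_eq0// [box_coord b i z]box_fun_out//; ring.
  rewrite box_coord_in// /rho [box_psi b' z]box_fun_in//.
  by rewrite [box_fun _ z]box_fun_in// b'c /cst -/c; ring.
have Y1 : rho q ^+ 2 * Y f q =
    rho q * \sum_i Y (box_fun (xsm i)) q * 'D_(delta_mx 0 i) F x.
  have Ysum (u v : 'I_m -> smoothfun M) : Y (\sum_i u i * v i) q =
      \sum_i (Y (u i) q * v i q + u i q * Y (v i) q).
    rewrite linear_sum smoothfun_sumE.
    by apply: eq_bigr => i _; exact: vfield_mul_at.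
  have : Y (rho * rho * f) q = Y (f q *: (rho * rho) +
      \sum_i box_fun (xsm i) * box_fun (hsm' i)) q by rewrite E1.
  rewrite vfieldD vfieldZ [Y (_ * f)]vfield_leibniz.
  rewrite -[_ q in LHS]/(Y (rho * rho) q * f q + (rho q * rho q) * Y f q).
  rewrite -[_ q in RHS]/(f q * Y (rho * rho) q + Y (\sum_i _) q) Ysum.
  rewrite mulrC => /addrI; rewrite expr2 => ->.
  rewrite mulr_sumr; apply: eq_bigr => i _.
  by rewrite xi0 hi0 mul0r addr0; ring.
have Y2 i : box_psi b q ^+ 2 * Y (box_fun (xsm i)) q = rho q * box_coef b Y i q.
  have : Y (box_psi b) q * box_fun (xsm i) q + box_psi b q * Y (box_fun (xsm i)) q =
      Y rho q * box_coord b i q + rho q * Y (box_coord b i) q -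
      x 0 i * (Y rho q * box_psi b q + rho q * Y (box_psi b) q).
    have : Y (box_psi b * box_fun (xsm i)) q =
        Y (rho * box_coord b i - x 0 i *: (rho * box_psi b)) q by rewrite E2.
    by rewrite vfieldB vfieldZ !vfield_leibniz.
  rewrite xi0 bcx => E.
  have -> : box_coef b Y i q = box_psi b q * Y (box_coord b i) q
    - box_coord b i q * Y (box_psi b) q by [].
  rewrite bcx expr2 -mulrA.
  have -> : box_psi b q * Y (box_fun (xsm i)) q =
    rho q * Y (box_coord b i) q - x 0 i * rho q * Y (box_psi b) q by lra.
  ring.
apply: (mulfI (lt0r_neq0 rho0)); apply: (mulfI (lt0r_neq0 rho0)).
transitivity (box_psi b q ^+ 3 * (rho q ^+ 2 * Y f q)); first by ring.
rewrite Y1 mulrCA; congr (_ * _); rewrite !mulr_sumr; apply: eq_bigr => i _.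
have -> : box_field b i f q = box_psi b q * 'D_(delta_mx 0 i) F x.
  by rewrite [LHS]box_fun_in// box_fun_in// mulr1.
transitivity (box_psi b q * 'D_(delta_mx 0 i) F x *
  (box_psi b q ^+ 2 * Y (box_fun (xsm i)) q)); first by ring.
by rewrite Y2; ring.
Qed.

Lemma box_frame b Y : box_psi b ^+ 3 *: Y = \sum_i box_coef b Y i *: box_field b i.
Proof.
apply: vfieldP => f; apply/val_inj/funext => q.
transitivity (box_psi b q ^+ 3 * Y f q); first by rewrite !exprS !expr0.
transitivity (\sum_i box_coef b Y i q * box_field b i f q); last first.
  by rewrite -(smoothfun_sumE _ (fun i => box_coef b Y i * box_field b i f))
    -(vfield_sumE _ (fun i => box_coef b Y i *: box_field b i)).
have [bq|nbq] := pselect (in_box b q); first exact: box_expansion.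
rewrite box_psi_eq0// expr0n mul0r big1// => i _.
by rewrite [X in _ * X]box_fun_out// mulr0.
Qed.

End box_frames.
Section scalar_maps.
Variables (R : realType) (m : nat) (M : manifold R m).
Variables (w : vfield M -> smoothfun M) (w_scalar : scalar w).
Implicit Types (X Y : vfield M).

Lemma scalar0 : w 0 = 0.
Proof. by have := w_scalar (-1) 0 0; rewrite scaler0 addr0 mulN1r addNr. Qed.

Lemma scalarD X Y : w (X + Y) = w X + w Y.
Proof. by have := w_scalar 1 X Y; rewrite scale1r mul1r. Qed.

Lemma scalarZ u X : w (u *: X) = u * w X.
Proof. by have := w_scalar u X 0; rewrite scalar0 !addr0. Qed.

Lemma scalarN X : w (- X) = - w X.
Proof. by rewrite -scaleN1r scalarZ mulN1r. Qed.

Lemma scalarB X Y : w (X - Y) = w X - w Y.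
Proof. by rewrite scalarD scalarN. Qed.

Lemma scalar_sum (I : Type) (s : seq I) (X : I -> vfield M) :
  w (\sum_(i <- s) X i) = \sum_(i <- s) w (X i).
Proof. by apply: (big_morph w _ scalar0) => X' Y'; exact: scalarD. Qed.

(** Tensoriality: in the frame expansion around [p] the coefficients at [p] involve [X] only through
    its value there, and psi does not vanish at [p]. *)
Lemma scalar_at0 (X : vfield M) p : vf_at X p = (fun=> 0) -> w X p = 0.
Proof.
move=> X0; have [c Mc cp] := atlas_cover p.
have [b [_ bp _ _]] := box_exists Mc cp (@chart_cod_open _ _ _ c)
  (@subset_refl _ _) (chart_funP cp).
have X0' f : X f p = 0 by rewrite -[LHS]/(vf_at X p f) X0.
have psi0 := box_psi_gt0 bp.
have := congr1 (fun Y => w Y p) (box_frame b X).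
rewrite scalarZ scalar_sum smoothfun_sumE big1.
  move=> E; apply: (mulfI (lt0r_neq0 (exprn_gt0 3 psi0))); rewrite mulr0 -E.
  by rewrite !exprS !expr0.
move=> i _; rewrite scalarZ.
transitivity ((box_psi b p * X (box_coord b i) p - box_coord b i p * X (box_psi b) p)
  * w (box_field b i) p) => //.
by rewrite !X0' !mulr0 subrr mul0r.
Qed.

End scalar_maps.

(** * Riesz representation of 1-forms *)

Section riesz.
Variables (R : realType) (m : nat) (M : manifold R m) (g : riem_metric M).
Implicit Types (p q : M) (f : smoothfun M) (X Y : vfield M) (b : box M).

Lemma metric_scalar_left Y : scalar (g^~ Y).
Proof. by move=> u X X'; rewrite !(riem_sym g _ Y) riem_linear. Qed.

Lemma metric_at0 X p : g X X p = 0 -> vf_at X p = (fun=> 0).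
Proof.
move=> gX0; apply: contrapT => /(@riem_pos _ _ _ g); rewrite gX0.
by rewrite ltxx.
Qed.

Lemma metric_definite X : g X X = 0 -> X = 0.
Proof.
move=> gX; apply: vfieldP => f; apply/val_inj/funext => p.
have : vf_at X p = (fun=> 0) by apply: metric_at0; rewrite gX.
by move=> /(congr1 (fun v => v f)).
Qed.

Lemma metric_inj X Y : (forall Z, g X Z = g Y Z) -> X = Y.
Proof.
move=> gXY; apply/eqP; rewrite -subr_eq0; apply/eqP/metric_definite.
have E Z : g (X - Y) Z = 0; last exact: E.
by rewrite (scalarB (metric_scalar_left Z)) gXY subrr.
Qed.

Definition gram b : 'M[smoothfun M]_m :=
  \matrix_(i, j) g (box_field b i) (box_field b j).

Lemma box_field_box_fun b (u : 'rV[R]_m -> R) (Cu : smooth_on (box_nbhs b) u)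
    i p : in_box b p ->
  box_field b i (box_fun Cu) p = box_psi b p * (
    box_psi b p * 'D_(delta_mx 0 i) u (box_chart b p) +
    u (box_chart b p) * 'D_(delta_mx 0 i) (box_bump b) (box_chart b p)).
Proof.
move=> bp; have -> : box_psi b p = box_bump b (box_chart b p).
  by rewrite box_fun_in// /cst mulr1.
rewrite [LHS]box_fun_in//; congr (_ * _).
set x := box_chart b p.
have xV : box_nbhs b x by apply: box_closed; apply: ball_closed_box; exact: bp.2.
have xV' := open_nbhs_nbhs (conj (@box_open _ _ _ b) xV).
have E : {near x, (box_fun Cu \o chart_inv (box_chart b)) =1 box_bump b \* u}.
  apply: filterS xV' => y /box_nbhs_cod yc.
  by rewrite /= /chart_extend asboolT ?chart_invK//; exact: chart_invP.
rewrite (near_eq_derive _ E); apply: (@deriveM _ _ (box_bump b) u).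
  exact: Ck_on_derivable (Ck_on_bump _ _ 1 (@box_open _ _ _ b)) xV.
exact: Ck_on_derivable (Cu 1%N) xV.
Qed.

(** A kernel vector of the Gram matrix at [p] yields a constant combination of the frame fields of
    length zero at [p]. By positivity it vanishes there as a derivation, and evaluation on the
    cut-off coordinates shows that its coefficients are zero. *)
Lemma gram_det b p : in_box b p -> (\det (gram b) : smoothfun M) p != 0.
Proof.
move=> bp; pose G : 'M[R]_m := \matrix_(i, j) gram b i j p.
have -> : (\det (gram b) : smoothfun M) p = \det G.
  rewrite /determinant smoothfun_sumE; apply: eq_bigr => s _.
  rewrite -[LHS]/((GRing.exp (-1) s : smoothfun M) p * (\prod_i gram b i (s i)) p).
  rewrite smoothfun_prodE; congr (_ * _); first by case: (s : bool).
  by apply: eq_bigr => i _; rewrite !mxE.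
apply/negP => /det0P [v v0 vG].
pose W := \sum_i smooth_cst M (v 0 i) *: box_field b i.
have cstE a q : smooth_cst M a q = a by exact: mulr1.
have gW j : g W (box_field b j) p = 0.
  rewrite (scalar_sum (metric_scalar_left _)) smoothfun_sumE.
  transitivity ((v *m G) 0 j); last by rewrite vG mxE.
  rewrite [RHS]mxE; apply: eq_bigr => i _.
  rewrite (scalarZ (metric_scalar_left _)) !mxE.
  by rewrite -[in RHS](cstE (v 0 i) p).
have W0 : vf_at W p = (fun=> 0).
  apply: metric_at0; rewrite {2}/W (scalar_sum (riem_linear g W)) smoothfun_sumE.
  rewrite big1// => i _; rewrite (scalarZ (riem_linear g W)).
  by rewrite -[LHS]/(_ * g W (box_field b i) p) gW mulr0.
have WE f : \sum_i v 0 i * box_field b i f p = 0.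
  transitivity (vf_at W p f); last by rewrite W0.
  rewrite /vf_at /W vfield_sumE smoothfun_sumE; apply: eq_bigr => i _.
  by rewrite -[in LHS](cstE (v 0 i) p).
have psi0 := box_psi_gt0 bp.
case/negP: v0; apply/eqP/rowP => j; rewrite mxE.
have E1 := WE (box_coord b j); have E2 := WE (box_psi b).
(* Subtracting x_j times E_i(psi) from E_i(psi x_j) removes the derivative of the bump function and
   leaves psi^2 if i = j and 0 otherwise. *)
have : \sum_i v 0 i * (i == j)%:R * box_psi b p ^+ 2 = 0.
  have : \sum_i v 0 i * box_field b i (box_coord b j) p -
      box_chart b p 0 j * \sum_i v 0 i * box_field b i (box_psi b) p = 0.
    by rewrite E1 E2 mulr0 subrr.
  rewrite mulr_sumr -sumrB => E; rewrite -[RHS]E; apply: eq_bigr => i _.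
  rewrite !box_field_box_fun// derive_cst.
  have [_ ->] := is_derive_coord (box_chart b p) (delta_mx 0 i : 'rV[R]_m) j.
  by rewrite mxE eqxx /= eq_sym /cst; ring.
rewrite (bigD1 j)//= big1 => [|i /negbTE ->]; last by rewrite mulr0 mul0r.
rewrite eqxx mulr1 addr0 => /eqP; rewrite mulf_eq0 expf_eq0 /= (gt_eqF psi0) orbF.
by move=> /eqP.
Qed.

(** Cramer's rule without division: the adjugate in place of the inverse Gram matrix costs a factor
    [\det (gram b)], and expanding an arbitrary [Y] in the frame costs psi^3. Both are nonzero at
    [p]. *)
Lemma local_riesz (w : vfield M -> smoothfun M) p : scalar w ->
  exists (d : smoothfun M) X, d p != 0 /\ forall Y, g X Y = d * w Y.
Proof.
move=> lw; have [c Mc cp] := atlas_cover p.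
have [b [_ bp _ _]] := box_exists Mc cp (@chart_cod_open _ _ _ c)
  (@subset_refl _ _) (chart_funP cp).
pose wE : 'rV[smoothfun M]_m := \row_j w (box_field b j).
pose k := wE *m \adj (gram b).
pose X := \sum_i k 0 i *: box_field b i.
have gX j : g X (box_field b j) = \det (gram b) * w (box_field b j).
  have : k *m gram b = \det (gram b) *: wE.
    by rewrite -mulmxA mul_adj_mx mul_mx_scalar.
  move=> /(congr1 (fun A : 'rV[smoothfun M]_m => A 0 j)).
  rewrite [RHS]mxE [in RHS]mxE => <-; rewrite [RHS]mxE.
  rewrite (scalar_sum (metric_scalar_left _)); apply: eq_bigr => i _.
  by rewrite (scalarZ (metric_scalar_left _)) !mxE.
exists (box_psi b ^+ 3 * \det (gram b)), (box_psi b ^+ 3 *: X); split.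
  have := mulf_neq0 (expf_neq0 3 (lt0r_neq0 (box_psi_gt0 bp))) (gram_det bp).
  by rewrite !exprS !expr0.
move=> Y; rewrite (scalarZ (metric_scalar_left _)) -(scalarZ (riem_linear g X)).
rewrite box_frame (scalar_sum (riem_linear g X)).
rewrite -mulrA mulrCA -(scalarZ lw) box_frame (scalar_sum lw) mulr_sumr.
apply: eq_bigr => i _.
by rewrite (scalarZ (riem_linear g X)) gX (scalarZ lw) mulrCA.
Qed.

Lemma riesz (w : vfield M -> smoothfun M) : scalar w ->
  exists X, forall Y, g X Y = w Y.
Proof.
move=> lw.
have /choice[dX dXP] : forall p, exists dX : smoothfun M * vfield M,
    dX.1 p != 0 /\ forall Y, g dX.2 Y = dX.1 * w Y.
  by move=> p; have [d [X H]] := local_riesz p lw; exists (d, X).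
(* Both fields represent the form multiplied by the two factors, so nondegeneracy identifies them.
   The local quotients thus agree wherever both denominators are nonzero. *)
have agree p q : (dX p).1 *: (dX q).2 = (dX q).1 *: (dX p).2.
  apply: metric_inj => Y; rewrite !(scalarZ (metric_scalar_left _)).
  by rewrite (dXP p).2 (dXP q).2 mulrCA.
have agree_at p q f z : (dX p).1 z * (dX q).2 f z = (dX q).1 z * (dX p).2 f z.
  exact: (congr1 (fun X : vfield M => X f z) (agree p q)).
(* At each point the pair chosen for that very point is used, so the denominator never vanishes;
   near [p] the result coincides with the smooth quotient formed from the pair of [p]. *)
pose Xf f q := (dX q).2 f q / (dX q).1 q.
have XfE p f q : (dX p).1 q * Xf f q = (dX p).2 f q.
  rewrite /Xf mulrA agree_at mulrAC mulfV ?mul1r//.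
  exact: (dXP q).1.
have Xf_smooth f : Xf f \in @smooth R m M.
  apply: smooth_local => p; have [c Mc cp] := atlas_cover p.
  pose d := (dX p).1 \o chart_inv c.
  have dC := smoothfun_chart (dX p).1 Mc.
  pose W := chart_cod c `&` d @^-1` [set x | x != 0].
  have oW : open W.
    apply: open_preimage_within; [exact: chart_cod_open| |exact: open_neq].
    apply: continuous_in_subspaceT => x /set_mem cx.
    exact (Ck_on_cont (dC 0%N) cx).
  exists c, W; split=> //.
    by split; [exact: chart_funP|rewrite /d /= chart_funK//; exact: (dXP p).1].
  split=> [x []//|k].
  have Wc : W `<=` chart_cod c by move=> x [].
  have C1 := Ck_on_inv oW (fun x (Wx : W x) => Wx.2) (Ck_on_subset Wc (dC k)).
  have C2 := Ck_on_subset Wc (smoothfun_chart ((dX p).2 f) Mc k).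
  apply: (Ck_on_eq oW _ (Ck_on_mul oW C2 C1)) => x [cx dx] /=.
  by rewrite -(XfE p) mulrAC mulfV ?mul1r.
pose Xs f := SmoothFun (Xf_smooth f).
have XsE f p q : (dX p).1 q * Xs f q = (dX p).2 f q by exact: XfE.
have Xs_linear : linear Xs.
  move=> a f h; apply/val_inj/funext => p.
  apply: (mulfI (dXP p).1); apply: (etrans (XsE _ p p)).
  transitivity ((dX p).1 p * (a * Xs f p + Xs h p)) => //.
  by rewrite mulrDr mulrCA !XsE vfieldD vfieldZ.
have Xs_leibniz : leibniz Xs.
  move=> f h; apply/val_inj/funext => p.
  apply: (mulfI (dXP p).1); apply: (etrans (XsE _ p p)).
  transitivity ((dX p).1 p * (Xs f p * h p + f p * Xs h p)) => //.
  transitivity ((dX p).1 p * Xs f p * h p + f p * ((dX p).1 p * Xs h p)).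
    by rewrite !XsE vfield_leibniz.
  ring.
pose X := VField Xs_linear Xs_leibniz.
have XE p : (dX p).1 *: X = (dX p).2.
  apply: vfieldP => f; apply/val_inj/funext => q.
  exact: (XsE f p q).
exists X => Y; apply/val_inj/funext => p.
apply: (mulfI (dXP p).1).
transitivity (((dX p).1 * g X Y) p) => //.
by rewrite -(scalarZ (metric_scalar_left _)) XE (dXP p).2.
Qed.

End riesz.

(** * Almost 3-contact algebra *)

Section metric_algebra.
Variables (R : realType) (m : nat) (M : manifold R m) (g : riem_metric M).
Implicit Types (u f : smoothfun M) (X Y Z : vfield M).

Lemma metricDl X X' Y : g (X + X') Y = g X Y + g X' Y.
Proof. exact: (scalarD (metric_scalar_left g Y)). Qed.
Lemma metricDr X Y Y' : g X (Y + Y') = g X Y + g X Y'.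
Proof. exact: (scalarD (riem_linear g X)). Qed.
Lemma metricNl X Y : g (- X) Y = - g X Y.
Proof. exact: (scalarN (metric_scalar_left g Y)). Qed.
Lemma metricNr X Y : g X (- Y) = - g X Y.
Proof. exact: (scalarN (riem_linear g X)). Qed.
Lemma metricZl u X Y : g (u *: X) Y = u * g X Y.
Proof. exact: (scalarZ (metric_scalar_left g Y)). Qed.
Lemma metricZr u X Y : g X (u *: Y) = u * g X Y.
Proof. exact: (scalarZ (riem_linear g X)). Qed.
Lemma metric0l Y : g 0 Y = 0.
Proof. exact: (scalar0 (metric_scalar_left g Y)). Qed.
Lemma metric0r X : g X 0 = 0.
Proof. exact: (scalar0 (riem_linear g X)). Qed.
Lemma metric_suml (I : Type) (s : seq I) (X : I -> vfield M) Y :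
  g (\sum_(i <- s) X i) Y = \sum_(i <- s) g (X i) Y.
Proof. exact: (scalar_sum (metric_scalar_left g Y)). Qed.
Lemma metric_sumr (I : Type) (s : seq I) X (Y : I -> vfield M) :
  g X (\sum_(i <- s) Y i) = \sum_(i <- s) g X (Y i).
Proof. exact: (scalar_sum (riem_linear g X)). Qed.

Definition metricE := (metricDl, metricDr, metricNl, metricNr, metricZl,
  metricZr, metric0l, metric0r).

(** The ring of smooth functions may have zero divisors, but it is reduced; this replaces
    cancellation below. *)
Lemma smoothfun_sqr_eq0 u : u * u = 0 -> u = 0.
Proof.
move=> u0; apply/val_inj/funext => p; apply/eqP.
rewrite -sqrf_eq0 expr2; apply/eqP.
exact: (congr1 (fun f : smoothfun M => f p) u0).
Qed.

Lemma smoothfun_double_eq0 u : u + u = 0 -> u = 0.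
Proof.
move=> u0; apply/val_inj/funext => p.
have : u p + u p = 0 by exact: (congr1 (fun f : smoothfun M => f p) u0).
by move=> E; change (u p = 0); lra.
Qed.

Lemma vfieldN X f : X (- f) = - X f. Proof. exact: linearN. Qed.
Lemma vfield0 X : X 0 = 0. Proof. exact: linear0. Qed.

Lemma vfield1 X : X 1 = 0.
Proof.
have := vfield_leibniz X 1 1; rewrite !mulr1 mul1r => E.
by apply: (addrI (X 1)); rewrite addr0 -E.
Qed.

Lemma lieN X Y : lie Y X = - lie X Y.
Proof. by apply: vfieldP => f; symmetry; exact: opprB. Qed.

Lemma lieDl X X' Y : lie (X + X') Y = lie X Y + lie X' Y.
Proof.
apply: vfieldP => f.
rewrite -[LHS]/((X (Y f) + X' (Y f)) - Y (X f + X' f)) vfieldD.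
by rewrite opprD addrACA.
Qed.

Lemma lieZl u X Y : lie (u *: X) Y = u *: lie X Y - Y u *: X.
Proof.
apply: vfieldP => f.
rewrite -[LHS]/(u * X (Y f) - Y (u * X f)) vfield_leibniz.
rewrite -[RHS]/(u * (X (Y f) - Y (X f)) - Y u * X f); ring.
Qed.

Lemma lieDr X Y Y' : lie X (Y + Y') = lie X Y + lie X Y'.
Proof. by rewrite !(lieN _ X) lieDl opprD. Qed.

Lemma lieZr u X Y : lie X (u *: Y) = u *: lie X Y + X u *: Y.
Proof. by rewrite !(lieN _ X) lieZl opprB scalerN addrC. Qed.

Section almost_contact.
Variable s : acm_structure g.
Local Notation phi := (acm_phi s).
Local Notation xi := (acm_xi s).
Local Notation eta := (acm_eta s).

Lemma phiD X Y : acm_phi s (X + Y) = acm_phi s X + acm_phi s Y.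
Proof. exact: linearD. Qed.
Lemma phiN X : acm_phi s (- X) = - acm_phi s X.
Proof. exact: linearN. Qed.
Lemma phiZ u X : acm_phi s (u *: X) = u *: acm_phi s X.
Proof. exact: linearZ. Qed.
Lemma phi0 : acm_phi s 0 = 0.
Proof. exact: linear0. Qed.
Lemma etaD X Y : acm_eta s (X + Y) = acm_eta s X + acm_eta s Y.
Proof. exact: linearD. Qed.
Lemma etaN X : acm_eta s (- X) = - acm_eta s X.
Proof. exact: linearN. Qed.
Lemma etaZ u X : acm_eta s (u *: X) = u * acm_eta s X.
Proof. exact: linearZ. Qed.
Lemma eta0 : acm_eta s 0 = 0.
Proof. exact: linear0. Qed.
Lemma eta_sum (I : Type) (r : seq I) (X : I -> vfield M) :
  acm_eta s (\sum_(i <- r) X i) = \sum_(i <- r) acm_eta s (X i).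
Proof. exact: linear_sum. Qed.

(** Since phi^2 kills xi, the identity for phi^2 applied to phi xi makes phi xi a multiple of xi
    with coefficient eta(phi xi). Applying phi and eta once more shows that the square of this
    coefficient is zero. *)
Lemma phi_xi : phi xi = 0.
Proof.
have phi2xi : phi (phi xi) = 0 by rewrite acm_phi2 acm_eta_xi scale1r addNr.
have E : phi xi = eta (phi xi) *: xi.
  have := acm_phi2 s (phi xi); rewrite phi2xi phi0.
  by move=> /esym/eqP; rewrite addrC subr_eq0 => /eqP.
have : eta (phi xi) * eta (phi xi) = 0.
  have := congr1 eta phi2xi; rewrite {1}E phiZ {2}E !etaZ eta0 acm_eta_xi.
  by rewrite mulr1.
by move=> /smoothfun_sqr_eq0 e0; rewrite E e0 scale0r.
Qed.

Lemma eta_metric X : eta X = g X xi.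
Proof.
have := acm_metric s X xi; rewrite phi_xi metric0r acm_eta_xi mulr1.
by move=> /esym/eqP; rewrite subr_eq0 => /eqP.
Qed.

Lemma eta_phi X : eta (phi X) = 0.
Proof.
have : phi (phi (phi X)) = - phi X.
  by rewrite [phi (phi X)]acm_phi2 phiD phiN phiZ phi_xi scaler0 addr0.
rewrite acm_phi2 => /(canRL (addKr _)); rewrite opprK subrr.
by move=> /(congr1 eta); rewrite etaZ eta0 acm_eta_xi mulr1.
Qed.

Lemma phi_skew X Y : g (phi X) Y = - g X (phi Y).
Proof.
have := acm_metric s X (phi Y); rewrite eta_phi mulr0 subr0 => <-.
by rewrite acm_phi2 !metricE -eta_metric eta_phi mulr0 addr0 opprK.
Qed.

End almost_contact.
End metric_algebra.

(** * The splitting into horizontal and vertical fields *)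

Section horizontal_vertical.
Variables (R : realType) (n : nat) (M : manifold R (4 * n + 3)).
Variables (g : riem_metric M) (S : almost_3contact g).
Implicit Types (u f : smoothfun M) (X Y Z : vfield M).

(** In a product of permutations the left factor acts first, so this is the cycle 0, 1, 2. The
    identity, this cycle and its square are the even permutations of three indices. *)
Let cycle3 : 'S_3 := mulg (tperm 0 1) (tperm 0 2%:R).

Definition cyclic_compat (i j k : 'I_3) :=
 [/\ forall X, acm_phi (S k) X =
          acm_phi (S i) (acm_phi (S j) X) - acm_eta (S j) X *: acm_xi (S i),
        forall X, acm_phi (S k) X =
          - acm_phi (S j) (acm_phi (S i) X) + acm_eta (S i) X *: acm_xi (S j),
        acm_xi (S k) = acm_phi (S i) (acm_xi (S j)) /\
        acm_xi (S k) = - acm_phi (S j) (acm_xi (S i)),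
        forall X, acm_eta (S k) X = acm_eta (S i) (acm_phi (S j) X) &
        forall X, acm_eta (S k) X = - acm_eta (S j) (acm_phi (S i) X)].

Lemma cyclic_compatP :
  [/\ cyclic_compat 0 1 2%:R, cyclic_compat 1 2%:R 0 & cyclic_compat 2%:R 0 1].
Proof.
have e1 : ~~ odd_perm (1%g : 'S_3) by rewrite odd_perm1.
have e2 : ~~ odd_perm cycle3 by rewrite odd_permM !odd_tperm.
have e3 : ~~ odd_perm (cycle3 * cycle3)%g by rewrite odd_permM addbb.
have c0 : cycle3 0 = 1 by rewrite permM tpermL tpermD.
have c1 : cycle3 1 = 2%:R by rewrite permM tpermR tpermL.
have c2 : cycle3 2%:R = 0 by rewrite permM [tperm 0 1 _]tpermD// tpermR.
have compat (s : 'S_3) i j k : ~~ odd_perm s -> s 0 = i -> s 1 = j ->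
    s 2%:R = k -> cyclic_compat i j k.
  move=> es <- <- <-; exact (acm3_compat S es).
split; first by apply: (compat _ _ _ _ e1); exact: perm1.
  exact: (compat _ _ _ _ e2).
by apply: (compat _ _ _ _ e3); rewrite permM ?c0 ?c1 ?c2.
Qed.

Lemma ord3_cases (i : 'I_3) : [\/ i = 0, i = 1 | i = 2%:R].
Proof.
case: i => [[|[|[|//]]] H]; [apply: Or31|apply: Or32|apply: Or33];
  exact: val_inj.
Qed.

Local Notation xi i := (acm_xi (S i)).
Local Notation eta i := (acm_eta (S i)).
Local Notation H := (horizontal S).

Lemma eta_xi i j : eta i (xi j) = (i == j)%:R.
Proof.
have eta_phi0 a b c : cyclic_compat a b c -> eta a (xi c) = 0 /\ eta b (xi c) = 0.
  move=> [_ _ [E1 E2] _ _]; split; first by rewrite E1 eta_phi.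
  by rewrite E2 etaN eta_phi oppr0.
have [/eta_phi0[e1 e2] /eta_phi0[e3 e4] /eta_phi0[e5 e6]] := cyclic_compatP.
by case: (ord3_cases i) => ->; case: (ord3_cases j) => ->;
  rewrite ?acm_eta_xi ?e1 ?e2 ?e3 ?e4 ?e5 ?e6.
Qed.

Lemma metric_xi i j : g (xi i) (xi j) = (i == j)%:R.
Proof. by rewrite -eta_metric eta_xi eq_sym. Qed.

(** For distinct indices, eta_a composed with phi_b is plus or minus the third form, and it is zero
    for equal ones. *)
Lemma horizontal_phi i X : H X -> H (acm_phi (S i) X).
Proof.
move=> HX k.
have vanish a b c : cyclic_compat a b c ->
    eta a (acm_phi (S b) X) = 0 /\ eta b (acm_phi (S a) X) = 0.
  move=> [_ _ _ E1 E2]; rewrite -E1 HX; split=> //.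
  by apply: oppr_inj; rewrite -E2 HX oppr0.
have [/vanish[e1 e2] /vanish[e3 e4] /vanish[e5 e6]] := cyclic_compatP.
by case: (ord3_cases i) => ->; case: (ord3_cases k) => ->;
  rewrite ?eta_phi ?e1 ?e2 ?e3 ?e4 ?e5 ?e6.
Qed.

Lemma horizontal0 : H 0.
Proof. by move=> i; exact: eta0. Qed.

Lemma horizontalD X Y : H X -> H Y -> H (X + Y).
Proof. by move=> HX HY i; rewrite etaD HX HY addr0. Qed.

Lemma horizontalZ u X : H X -> H (u *: X).
Proof. by move=> HX i; rewrite etaZ HX mulr0. Qed.

Lemma horizontalN X : H X -> H (- X).
Proof. by move=> HX i; rewrite etaN HX oppr0. Qed.

Lemma horizontalB X Y : H X -> H Y -> H (X - Y).
Proof. by move=> HX HY; apply/horizontalD => //; exact: horizontalN. Qed.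

Lemma horizontal_sum (I : Type) (r : seq I) (X : I -> vfield M) :
  (forall i, H (X i)) -> H (\sum_(i <- r) X i).
Proof.
by move=> HX k; rewrite eta_sum big1// => i _; exact: HX.
Qed.

Lemma horizontalP X : H X <-> forall i, g X (xi i) = 0.
Proof. by split=> HX i; have := HX i; rewrite eta_metric. Qed.

Definition vpart X : vfield M := \sum_i eta i X *: xi i.
Definition hpart X : vfield M := X - vpart X.

Lemma hpart_vpart X : X = hpart X + vpart X.
Proof. by rewrite subrK. Qed.

Lemma eta_vpart k X : eta k (vpart X) = eta k X.
Proof.
rewrite eta_sum (bigD1 k)//= etaZ eta_xi eqxx mulr1 big1 ?addr0// => i ik.
by rewrite etaZ eta_xi eq_sym (negbTE ik) mulr0.
Qed.

Lemma horizontal_hpart X : H (hpart X).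
Proof. by move=> k; rewrite etaD etaN eta_vpart subrr. Qed.

Lemma metric_hpart_vpart X Y : H X -> g X (vpart Y) = 0.
Proof.
move=> /horizontalP HX; rewrite metric_sumr big1// => i _.
by rewrite metricZr HX mulr0.
Qed.

Lemma metric_hpart X Y : H X -> g X Y = g X (hpart Y).
Proof. by move=> HX; rewrite {1}(hpart_vpart Y) metricDr metric_hpart_vpart// addr0. Qed.

Lemma hpart_id X : H X -> hpart X = X.
Proof.
by move=> HX; rewrite /hpart /vpart big1 ?subr0// => i _; rewrite HX scale0r.
Qed.

Lemma hpartD X Y : hpart (X + Y) = hpart X + hpart Y.
Proof.
rewrite /hpart addrACA -opprD; congr (_ - _).
by rewrite /vpart -big_split; apply: eq_bigr => i _; rewrite etaD scalerDl.
Qed.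

Lemma hpartZ u X : hpart (u *: X) = u *: hpart X.
Proof.
rewrite /hpart scalerBr; congr (_ - _).
by rewrite /vpart scaler_sumr; apply: eq_bigr => i _; rewrite etaZ scalerA.
Qed.

Lemma hpart_xi i : hpart (xi i) = 0.
Proof.
rewrite /hpart /vpart (bigD1 i)//= eta_xi eqxx scale1r big1 ?addr0 ?subrr//.
by move=> j ji; rewrite eta_xi (negbTE ji) scale0r.
Qed.

Lemma horizontal_eq0 W : H W -> (forall Z, H Z -> g W Z = 0) -> W = 0.
Proof. by move=> HW gW; apply: (@metric_definite _ _ _ g); exact: gW. Qed.

(** The coefficients of a vertical field are given point by point, without any smoothness. Freezing
    those at [p] into constants gives a global combination of the xi_i with the same value at [p],
    and tensoriality does the rest. *)
Lemma vertical_perp X Y : vertical S Y -> H X -> g Y X = 0.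
Proof.
move=> VY HX; apply/val_inj/funext => p; have [c Yc] := VY p.
pose W := Y - \sum_i smooth_cst M (c i) *: xi i.
have W0 : vf_at W p = (fun=> 0).
  apply/funext => f.
  transitivity (vf_at Y p f - (\sum_i smooth_cst M (c i) *: xi i) f p) => //.
  rewrite Yc vfield_sumE smoothfun_sumE; apply/eqP; rewrite subr_eq0; apply/eqP.
  apply: eq_bigr => i _.
  by rewrite -[RHS]/(c i * 1 * (xi i) f p) mulr1.
have := scalar_at0 (metric_scalar_left g X) W0.
rewrite metricDl metricNl metric_suml big1 ?subr0// => i _.
by rewrite metricZl riem_sym (proj1 (horizontalP X) HX) mulr0.
Qed.

Lemma perp_vertical Y : (forall X, H X -> g Y X = 0) -> vertical S Y.
Proof.
move=> gY p; exists (fun i => eta i Y p); apply/funext => f.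
have -> : Y = vpart Y.
  rewrite {1}(hpart_vpart Y); suff -> : hpart Y = 0 by rewrite add0r.
  apply: horizontal_eq0 => [|Z HZ]; first exact: horizontal_hpart.
  by rewrite riem_sym -metric_hpart// riem_sym gY.
rewrite /vf_at vfield_sumE smoothfun_sumE; apply: eq_bigr => i _.
by rewrite eta_vpart.
Qed.

Section sphere.
Variables (s : acm_structure g) (sS : assoc_sphere S s).
Local Notation phi := (acm_phi s).

Lemma sphere_horizontal_phi X : H X -> H (phi X).
Proof.
have [a [_ E _ _]] := sS => HX; rewrite E; apply: horizontal_sum => i.
exact/horizontalZ/horizontal_phi.
Qed.

Lemma sphere_eta0 X : H X -> acm_eta s X = 0.
Proof. by have [a [_ _ _ E]] := sS => HX; rewrite E big1// => i _; rewrite HX mulr0. Qed.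

Lemma sphere_metric_xi X : H X -> g X (acm_xi s) = 0.
Proof. by move=> HX; rewrite -eta_metric sphere_eta0. Qed.

Lemma sphere_phi2 X : H X -> phi (phi X) = - X.
Proof. by move=> HX; rewrite acm_phi2 sphere_eta0// scale0r addr0. Qed.

End sphere.
End horizontal_vertical.

(** * Metric connections with prescribed torsion *)

Section connections.
Variables (R : realType) (m : nat) (M : manifold R m) (g : riem_metric M).
Variable nb : connection M.
Implicit Types (u f : smoothfun M) (X Y Z : vfield M).

Lemma nablaDl X X' Y : nb (X + X') Y = nb X Y + nb X' Y.
Proof. by have := nabla_linear nb Y 1 X X'; rewrite !scale1r. Qed.

Lemma nabla0l Y : nb 0 Y = 0.
Proof. by apply: (addrI (nb 0 Y)); rewrite -nablaDl !addr0. Qed.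

Lemma nablaZl u X Y : nb (u *: X) Y = u *: nb X Y.
Proof. by have := nabla_linear nb Y u X 0; rewrite nabla0l !addr0. Qed.

Lemma nablaNl X Y : nb (- X) Y = - nb X Y.
Proof. by rewrite -scaleN1r nablaZl scaleN1r. Qed.

Lemma nabla_suml (I : Type) (s : seq I) (X : I -> vfield M) Y :
  nb (\sum_(i <- s) X i) Y = \sum_(i <- s) nb (X i) Y.
Proof. by apply: (big_morph (nb^~ Y) _ (nabla0l Y)) => ? ?; exact: nablaDl. Qed.

Lemma nabla0r X : nb X 0 = 0.
Proof. by apply: (addrI (nb X 0)); rewrite -nabla_add !addr0. Qed.

Lemma nablaNr X Y : nb X (- Y) = - nb X Y.
Proof. by apply: (addrI (nb X Y)); rewrite -nabla_add !subrr nabla0r. Qed.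

Lemma metric_lie X Y Z :
  g (lie X Y) Z = g (nb X Y) Z - g (nb Y X) Z - torsion3 g nb X Y Z.
Proof.
have -> : lie X Y = nb X Y - nb Y X - torsion nb X Y.
  by rewrite /torsion opprB addrC subrK.
by rewrite metricDl metricDl !metricNl.
Qed.

Hypothesis metric_nb : metric_connection g nb.
Hypothesis skew_nb : skew_torsion g nb.

Lemma torsion3_skewl X Y Z : torsion3 g nb X Y Z = - torsion3 g nb Y X Z.
Proof. by have [_ _ _ h] := skew_nb; have [] := h X Y Z I I I. Qed.

Lemma torsion3_skewr X Y Z : torsion3 g nb X Y Z = - torsion3 g nb X Z Y.
Proof. by have [_ _ _ h] := skew_nb; have [] := h X Y Z I I I. Qed.

Variable s : acm_structure g.
Local Notation phi := (acm_phi s).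

(* The tensor [g ((nabla_X phi) Y) Z]. *)
Definition dphi X Y Z := g (nb X (phi Y)) Z + g (nb X Y) (phi Z).

Lemma dphi_skew X Y Z : dphi X Z Y = - dphi X Y Z.
Proof.
apply/eqP; rewrite -addr_eq0 /dphi; apply/eqP.
have E1 := metric_nb X (phi Z) Y; have E2 := metric_nb X Z (phi Y).
move: E1; rewrite phi_skew vfieldN E2 !(riem_sym g _ (nb _ _)) => E1.
transitivity (g (nb X (phi Z)) Y + g (nb X Y) (phi Z) +
  (g (nb X Z) (phi Y) + g (nb X (phi Y)) Z)); first by ring.
by rewrite -E1 addNr.
Qed.

Lemma dphiNl X Y Z : dphi (- X) Y Z = - dphi X Y Z.
Proof. by rewrite /dphi !nablaNl !metricE; ring. Qed.

Lemma dphi_phi X Y Z : phi (phi Y) = - Y -> phi (phi Z) = - Z ->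
  dphi X (phi Y) Z = dphi X Y (phi Z).
Proof. by move=> Y2 Z2; rewrite /dphi Y2 Z2 nablaNr !metricE addrC. Qed.

(** Derivatives of the metric are expanded by the metric connection and each bracket is written
    through nabla and the torsion; all remaining terms in nabla combine into [dphi]. *)
Lemma ext_d2_torsion X Y Z :
  ext_d2 (fundamental_form s) X Y Z =
    torsion3 g nb X Y (phi Z) - torsion3 g nb X Z (phi Y)
    + torsion3 g nb Y Z (phi X)
    - (dphi X Y Z + dphi Y Z X + dphi Z X Y).
Proof.
have E (A B C : vfield M) : A (g B (phi C)) =
    g (nb A B) (phi C) + dphi A C B - g (nb A C) (phi B).
  by rewrite metric_nb (riem_sym g B) /dphi; ring.
rewrite /ext_d2 /fundamental_form !E !metric_lie.
rewrite (dphi_skew X Y Z) (dphi_skew Z X Y); ring.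
Qed.

(** Pairing with a field orthogonal to xi removes the d eta term, and skew symmetry moves every
    outer phi to [Z]. *)
Lemma nijenhuis3E X Y Z : g Z (acm_xi s) = 0 -> phi (phi Z) = - Z ->
  nijenhuis3 s X Y Z = g (lie (phi X) (phi Y)) Z - g (lie X Y) Z
    + g (lie (phi X) Y) (phi Z) + g (lie X (phi Y)) (phi Z).
Proof.
move=> Zxi Z2; rewrite /nijenhuis3 /nijenhuis !metricE.
by rewrite (riem_sym g _ Z) (riem_sym g (acm_xi s)) Zxi !phi_skew Z2 metricE
  (riem_sym g Z); ring.
Qed.

Lemma nijenhuis3_torsion X Y Z : g Z (acm_xi s) = 0 ->
  phi (phi X) = - X -> phi (phi Y) = - Y -> phi (phi Z) = - Z ->
  nijenhuis3 s X Y Z =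
    (torsion3 g nb X Y Z - torsion3 g nb (phi X) (phi Y) Z
      - torsion3 g nb (phi X) Y (phi Z) - torsion3 g nb X (phi Y) (phi Z))
    + (dphi (phi X) Y Z - dphi (phi Y) X Z - dphi Y X (phi Z) + dphi X Y (phi Z)).
Proof.
move=> Zxi X2 Y2 Z2; rewrite nijenhuis3E// !metric_lie /dphi Z2 !metricE; ring.
Qed.

End connections.

(** * The Koszul formula with torsion *)

Section koszul.
Variables (R : realType) (m : nat) (M : manifold R m) (g : riem_metric M).
Implicit Types (u f : smoothfun M) (X Y Z : vfield M).

(** Skew symmetry in adjacent arguments carries linearity from the first argument to the other
    two. *)
Lemma form3_intro (w : vfield M -> vfield M -> vfield M -> smoothfun M) :
  (forall u X X' Y Z, w (u *: X + X') Y Z = u * w X Y Z + w X' Y Z) ->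
  (forall X Y Z, w Y X Z = - w X Y Z) ->
  (forall X Y Z, w X Z Y = - w X Y Z) ->
  form3_on setT w.
Proof.
move=> wl w12 w23; split=> [u X X' Y Z _ _ _ _|u X Y Y' Z _ _ _ _
  |u X Y Z Z' _ _ _ _|X Y Z _ _ _]; first exact: wl.
- by rewrite !(w12 _ X Z) wl; ring.
- by rewrite !(w23 X _ Y) !(w12 _ X Y) wl; ring.
- by split; [exact: w12|exact: w23].
Qed.

(** Twice the scalar product of [Z] with the Levi-Civita derivative of [Y] along [X]. *)
Definition koszul X Y Z : smoothfun M :=
  X (g Y Z) + Y (g X Z) - Z (g X Y)
  + g (lie X Y) Z - g (lie X Z) Y - g (lie Y Z) X.

Definition half : smoothfun M := smooth_cst M 2^-1.

Lemma half_double : half + half = 1.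
Proof.
apply/val_inj/funext => p.
change (2^-1 * 1 + 2^-1 * 1 = 1 :> R); lra.
Qed.

(** The Koszul expression plus T is linear over smooth functions in its last argument, so [riesz]
    supplies the derivative, and the axioms of a connection are checked against all fields. The
    explicit formula is part of the conclusion because the invariance of the horizontal distribution
    is read off from it. *)
Lemma metric_connection_exists (T : vfield M -> vfield M -> vfield M -> smoothfun M) :
  form3_on setT T ->
  exists nb : connection M, [/\ metric_connection g nb,
    forall X Y Z, torsion3 g nb X Y Z = T X Y Z &
    forall X Y Z, g (nb X Y) Z = half * (koszul X Y Z + T X Y Z)].
Proof.
move=> [T1 T2 T3 T4].
have /choice[nb2 nb2P] : forall XY : vfield M * vfield M, exists V,
    forall Z, g V Z = half * (koszul XY.1 XY.2 Z + T XY.1 XY.2 Z).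
  move=> [X Y]; apply: riesz => u Z Z' /=.
  rewrite T3// /koszul.
  rewrite !(metricE, lieZr, lieDr, vfieldD, vfield_leibniz).
  rewrite -[(u *: Z + Z') (g X Y)]/(u * Z (g X Y) + Z' (g X Y)).
  by rewrite (riem_sym g Z X) (riem_sym g Z Y); ring.
pose nb X Y := nb2 (X, Y).
have nbE X Y Z : g (nb X Y) Z = half * (koszul X Y Z + T X Y Z) by exact: nb2P.
have nb_lin Y : linear (nb^~ Y).
  move=> u X X'; apply: (@metric_inj _ _ _ g) => Z.
  rewrite !(metricDl, metricZl, nbE) T1// /koszul.
  rewrite !(metricE, lieZl, lieDl, vfieldD, vfield_leibniz).
  rewrite -[(u *: X + X') (g Y Z)]/(u * X (g Y Z) + X' (g Y Z)).
  ring.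
have nb_add X Y Z : nb X (Y + Z) = nb X Y + nb X Z.
  apply: (@metric_inj _ _ _ g) => W.
  have TD : T X (Y + Z) W = T X Y W + T X Z W.
    by have := T2 1 X Y Z W I I I I; rewrite scale1r mul1r.
  rewrite metricDl !nbE TD /koszul.
  rewrite !(metricE, lieDl, lieDr, vfieldD).
  rewrite -[(Y + Z) (g X W)]/(Y (g X W) + Z (g X W)).
  ring.
have nb_leib X f Y : nb X (f *: Y) = X f *: Y + f *: nb X Y.
  apply: (@metric_inj _ _ _ g) => Z.
  have T0 : T X 0 Z = 0.
    have := T2 1 X 0 0 Z I I I I; rewrite scale1r addr0 mul1r => E.
    by apply: (addrI (T X 0 Z)); rewrite addr0 -E.
  have TZ : T X (f *: Y) Z = f * T X Y Z.
    by have := T2 f X Y 0 Z I I I I; rewrite T0 !addr0.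
  rewrite metricDl !metricZl !nbE TZ /koszul.
  rewrite !(metricE, lieZl, lieZr, vfield_leibniz).
  rewrite -[(f *: Y) (g X Z)]/(f * Y (g X Z)).
  (* For [ring] the function [half] is an atom; the sum is isolated so that [half_double] can turn
     it into 1. *)
  transitivity ((half + half) * (X f * g Y Z) + f * (half * (koszul X Y Z + T X Y Z))).
    rewrite /koszul (riem_sym g Y X); ring.
  by rewrite half_double /koszul; ring.
pose nabla := Connection nb_lin nb_add nb_leib.
exists nabla; split=> //.
- move=> X Y Z; rewrite (riem_sym g Y (nabla X Z)) !nbE.
  have -> : T X Z Y = - T X Y Z.
    by have [_ ->] := T4 X Y Z I I I; rewrite opprK.
  transitivity ((half + half) * X (g Y Z)); first by rewrite half_double mul1r.
  rewrite /koszul (lieN Y Z) metricNl (riem_sym g Z Y).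
  ring.
move=> X Y Z; rewrite /torsion3 /torsion metricDl metricDl !metricNl.
rewrite -[nabla X Y]/(nb X Y) -[nabla Y X]/(nb Y X) !nbE.
have -> : T Y X Z = - T X Y Z.
  by have [-> _] := T4 X Y Z I I I; rewrite opprK.
transitivity ((half + half) * (g (lie X Y) Z + T X Y Z) - g (lie X Y) Z); last first.
  by rewrite half_double; ring.
rewrite /koszul (lieN X Y) metricNl (riem_sym g Y X).
ring.
Qed.

End koszul.

(** * The exterior derivative of a 2-form is a 3-form *)

Section exterior_derivative.
Variables (R : realType) (m : nat) (M : manifold R m).
Implicit Types (u : smoothfun M) (X Y Z : vfield M).
Variable w : vfield M -> vfield M -> smoothfun M.
Hypothesis w_linear : forall Y, scalar (w^~ Y).
Hypothesis w_skew : forall X Y, w Y X = - w X Y.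

(** The derivatives of [u] arising from the Leibniz rule cancel those arising from the brackets. *)
Lemma ext_d2_linear u X X' Y Z :
  ext_d2 w (u *: X + X') Y Z = u * ext_d2 w X Y Z + ext_d2 w X' Y Z.
Proof.
have wD A B C : w (A + B) C = w A C + w B C by exact: (scalarD (w_linear C)).
have wN A C : w (- A) C = - w A C by exact: (scalarN (w_linear C)).
have wZ v A C : w (v *: A) C = v * w A C by exact: (scalarZ (w_linear C)).
have wDr A B C : w C (A + B) = w C A + w C B.
  by rewrite !(w_skew _ C) wD opprD.
have wZr v A C : w C (v *: A) = v * w C A by rewrite !(w_skew _ C) wZ mulrN.
rewrite /ext_d2 !(lieDl, lieZl, wD, wN, wZ, wDr, wZr, vfieldD, vfield_leibniz).
rewrite -[(u *: X + X') (w Y Z)]/(u * X (w Y Z) + X' (w Y Z)); ring.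
Qed.

Lemma ext_d2_skewl X Y Z : ext_d2 w Y X Z = - ext_d2 w X Y Z.
Proof.
rewrite /ext_d2 (lieN X Y) (scalarN (w_linear Z)) (w_skew X Y) vfieldN.
ring.
Qed.

Lemma ext_d2_skewr X Y Z : ext_d2 w X Z Y = - ext_d2 w X Y Z.
Proof.
rewrite /ext_d2 (lieN Y Z) (scalarN (w_linear X)) (w_skew Y Z) vfieldN.
ring.
Qed.

End exterior_derivative.

(** * The prescribed torsion as a 3-form *)

Section candidate_torsion.
Variables (R : realType) (n : nat) (M : manifold R (4 * n + 3)).
Variables (g : riem_metric M) (S : almost_3contact g) (s : acm_structure g).
Hypothesis sS : assoc_sphere S s.
Hypothesis nijenhuis_form3 : form3_on (horizontal S) (nijenhuis3 s).
Implicit Types (u f : smoothfun M) (X Y Z : vfield M).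

Local Notation phi := (acm_phi s).
Local Notation xi i := (acm_xi (S i)).
Local Notation eta i := (acm_eta (S i)).
Local Notation H := (horizontal S).
Local Notation h := (hpart S).

Definition torsion_hhh X Y Z : smoothfun M :=
  nijenhuis3 s X Y Z - ext_d2 (fundamental_form s) (phi X) (phi Y) (phi Z).

(** This is d eta_i on the horizontal parts, whose two derivative terms vanish. *)
Definition torsion_hhv i X Y : smoothfun M := - eta i (lie (h X) (h Y)).

Definition torsion_hvv i j X : smoothfun M := - g (lie (xi i) (xi j)) (h X).

(** Projections and contractions with the eta_i extend the prescribed components to all fields, and
    the cyclic sums make the result skew. The double sum runs over ordered pairs, yet on X, xi_i,
    xi_j with X horizontal only the pair (i, j) contributes, hence no factor 1/2. On three vertical
    fields the value is zero. *)
Definition candidate X Y Z : smoothfun M :=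
  torsion_hhh (h X) (h Y) (h Z)
  + \sum_i (eta i Z * torsion_hhv i X Y + eta i X * torsion_hhv i Y Z
            + eta i Y * torsion_hhv i Z X)
  + \sum_i \sum_j (torsion_hvv i j X * (eta i Y * eta j Z)
            + torsion_hvv i j Y * (eta i Z * eta j X)
            + torsion_hvv i j Z * (eta i X * eta j Y)).

Lemma fundamental_form_linear Y : scalar ((fundamental_form s)^~ Y).
Proof. by move=> u X X'; rewrite /fundamental_form !metricE. Qed.

Lemma fundamental_form_skew X Y : fundamental_form s Y X = - fundamental_form s X Y.
Proof. by rewrite /fundamental_form riem_sym phi_skew. Qed.

Lemma torsion_hhh_linear u X X' Y Z : H X -> H X' -> H Y -> H Z ->
  torsion_hhh (u *: X + X') Y Z = u * torsion_hhh X Y Z + torsion_hhh X' Y Z.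
Proof.
move=> HX HX' HY HZ; have [N1 _ _ _] := nijenhuis_form3.
rewrite /torsion_hhh N1// phiD phiZ.
rewrite (ext_d2_linear fundamental_form_linear fundamental_form_skew); ring.
Qed.

Lemma torsion_hhh_skewl X Y Z : H X -> H Y -> H Z ->
  torsion_hhh Y X Z = - torsion_hhh X Y Z.
Proof.
move=> HX HY HZ; have [_ _ _ N4] := nijenhuis_form3.
rewrite /torsion_hhh (proj1 (N4 Y X Z HY HX HZ)).
by rewrite (ext_d2_skewl fundamental_form_linear fundamental_form_skew); ring.
Qed.

Lemma torsion_hhh_skewr X Y Z : H X -> H Y -> H Z ->
  torsion_hhh X Z Y = - torsion_hhh X Y Z.
Proof.
move=> HX HY HZ; have [_ _ _ N4] := nijenhuis_form3.
rewrite /torsion_hhh (proj2 (N4 X Z Y HX HZ HY)).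
by rewrite (ext_d2_skewr fundamental_form_linear fundamental_form_skew); ring.
Qed.

Lemma torsion_hhh0 X Y : H X -> H Y -> torsion_hhh X Y 0 = 0.
Proof.
move=> HX HY; have H0 := horizontal0 S.
rewrite torsion_hhh_skewr// torsion_hhh_skewl// opprK.
have := torsion_hhh_linear (-1) H0 H0 HX HY.
by rewrite scaler0 addr0 mulN1r addNr.
Qed.

(** The derivative of [u] in the bracket multiplies a horizontal field, which eta_i kills. *)
Lemma torsion_hhv_linear i u X X' Y :
  torsion_hhv i (u *: X + X') Y = u * torsion_hhv i X Y + torsion_hhv i X' Y.
Proof.
rewrite /torsion_hhv hpartD hpartZ lieDl lieZl !etaD etaN !etaZ.
rewrite (horizontal_hpart S X i); ring.
Qed.

Lemma torsion_hhv_skew i X Y : torsion_hhv i Y X = - torsion_hhv i X Y.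
Proof. by rewrite /torsion_hhv (lieN (h X)) etaN. Qed.

Lemma torsion_hvv_linear i j u X X' :
  torsion_hvv i j (u *: X + X') = u * torsion_hvv i j X + torsion_hvv i j X'.
Proof. by rewrite /torsion_hvv hpartD hpartZ !metricE; ring. Qed.

Lemma torsion_hvv_skew i j X : torsion_hvv j i X = - torsion_hvv i j X.
Proof. by rewrite /torsion_hvv (lieN (xi i)) metricNl. Qed.

Lemma candidate_form3 : form3_on setT candidate.
Proof.
have Hh X : H (h X) by exact: horizontal_hpart.
apply: form3_intro => [u X X' Y Z|X Y Z|X Y Z]; rewrite /candidate.
- rewrite hpartD hpartZ torsion_hhh_linear//.
  pose F X i := eta i Z * torsion_hhv i X Y + eta i X * torsion_hhv i Y Z
            + eta i Y * torsion_hhv i Z X.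
  pose G X i j := torsion_hvv i j X * (eta i Y * eta j Z)
            + torsion_hvv i j Y * (eta i Z * eta j X)
            + torsion_hvv i j Z * (eta i X * eta j Y).
  have FE : \sum_i F (u *: X + X') i = u * \sum_i F X i + \sum_i F X' i.
    rewrite mulr_sumr -big_split; apply: eq_bigr => i _.
    rewrite /F !(torsion_hhv_skew i _ Z) !torsion_hhv_linear etaD etaZ /=; ring.
  have GE : \sum_i \sum_j G (u *: X + X') i j =
      u * \sum_i \sum_j G X i j + \sum_i \sum_j G X' i j.
    rewrite mulr_sumr -big_split; apply: eq_bigr => i _.
    rewrite /= mulr_sumr -big_split; apply: eq_bigr => j _.
    rewrite /G torsion_hvv_linear !etaD !etaZ /=; ring.
  by rewrite /F /G in FE GE; rewrite FE GE; ring.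
- rewrite torsion_hhh_skewl// !opprD -!sumrN; congr (_ + _ + _).
    apply: eq_bigr => i _.
    by rewrite (torsion_hhv_skew i X Y) (torsion_hhv_skew i Z X)
      (torsion_hhv_skew i Y Z); ring.
  (* Swapping two arguments of the form amounts to swapping the indices i and j, under which
     [torsion_hvv] changes sign. *)
  rewrite exchange_big/=; apply: eq_bigr => i _; rewrite -sumrN.
  apply: eq_bigr => j _; rewrite !(torsion_hvv_skew i j); ring.
rewrite torsion_hhh_skewr// !opprD -!sumrN; congr (_ + _ + _).
  apply: eq_bigr => i _.
  by rewrite (torsion_hhv_skew i X Y) (torsion_hhv_skew i Z X)
    (torsion_hhv_skew i Y Z); ring.
rewrite exchange_big/=; apply: eq_bigr => i _; rewrite -sumrN.
apply: eq_bigr => j _; rewrite !(torsion_hvv_skew i j); ring.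
Qed.

Lemma candidate_hhh X Y Z : H X -> H Y -> H Z ->
  candidate X Y Z = torsion_hhh X Y Z.
Proof.
move=> HX HY HZ; rewrite /candidate !hpart_id// [X in _ + X]big1; last first.
  by move=> i _; rewrite big1// => j _; rewrite !HX !HY !HZ; ring.
by rewrite big1 ?addr0// => i _; rewrite !HX !HY !HZ; ring.
Qed.

Lemma candidate_hhv X Y k : H X -> H Y ->
  candidate X Y (xi k) = - eta k (lie X Y).
Proof.
move=> HX HY; rewrite /candidate hpart_xi !hpart_id// torsion_hhh0// add0r.
rewrite [X in _ + X]big1; last first.
  by move=> i _; rewrite big1// => j _; rewrite !HX !HY; ring.
rewrite addr0 (bigD1 k)//= big1 => [|i ik]; rewrite !HX !HY !eta_xi.
  by rewrite eqxx mulr1n /torsion_hhv (hpart_id HX) (hpart_id HY); ring.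
by rewrite (negbTE ik) mulr0n; ring.
Qed.

Lemma candidate_hvv X i j : H X ->
  candidate X (xi i) (xi j) = - g (lie (xi i) (xi j)) X.
Proof.
move=> HX; have Hh := horizontal_hpart S X; have H0 := horizontal0 S.
rewrite /candidate !hpart_xi torsion_hhh0// add0r.
have lie0 Y : lie Y 0 = 0 by apply: (addrI (lie Y 0)); rewrite -lieDr !addr0.
rewrite big1 ?add0r; last first.
  move=> k _; rewrite (torsion_hhv_skew k X (xi j)) HX /torsion_hhv !hpart_xi.
  by rewrite !lie0 !eta0; ring.
rewrite (bigD1 i)//= [X in _ + X]big1; last first.
  move=> k ki; rewrite big1// => l _.
  rewrite !HX /torsion_hvv hpart_xi metric0r eta_xi (negbTE ki) mulr0n; ring.
rewrite addr0 (bigD1 j)//= big1; last first.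
  move=> k kj; rewrite !HX /torsion_hvv !hpart_xi !metric0r !eta_xi.
  by rewrite (negbTE kj) mulr0n; ring.
by rewrite !HX /torsion_hvv !hpart_xi !metric0r !eta_xi !eqxx !mulr1n hpart_id//; ring.
Qed.

End candidate_torsion.

(** * Compatible connections *)

Section compatible_connections.
Variables (R : realType) (n : nat) (M : manifold R (4 * n + 3)).
Variables (g : riem_metric M) (S : almost_3contact g) (s : acm_structure g).
Hypothesis sS : assoc_sphere S s.
Implicit Types (u f : smoothfun M) (X Y Z : vfield M).

Local Notation phi := (acm_phi s).
Local Notation xi i := (acm_xi (S i)).
Local Notation eta i := (acm_eta (S i)).
Local Notation H := (horizontal S).

Let Hphi X : H X -> H (phi X). Proof. exact: sphere_horizontal_phi. Qed.
Let phi2 X : H X -> phi (phi X) = - X. Proof. exact: sphere_phi2. Qed.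
Let Hxi X : H X -> g X (acm_xi s) = 0. Proof. exact: sphere_metric_xi. Qed.

(** * Necessity of the conditions and the torsion formulas *)

Section necessary.
Variable nb : connection M.
Hypothesis nb_compatible : compatible_connection S s nb.

Let metric_nb : metric_connection g nb.
Proof. by case: nb_compatible. Qed.
Let skew_nb : skew_torsion g nb.
Proof. by case: nb_compatible. Qed.
Let nbH X Y : H Y -> H (nb X Y).
Proof. by move=> HY; case: nb_compatible => _ _ h _ _; exact: h. Qed.

Let skewl := torsion3_skewl skew_nb.
Let skewr := torsion3_skewr skew_nb.

Lemma compatible_dphi X Y Z : H X -> H Y -> dphi nb s X Y Z = 0.
Proof.
case: nb_compatible => _ _ _ _ h HX HY; rewrite /dphi.
have /eqP := h X Y HX HY; rewrite subr_eq0 => /eqP ->.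
by rewrite phi_skew addNr.
Qed.

Lemma compatible_nijenhuis X Y Z : H X -> H Y -> H Z ->
  nijenhuis3 s X Y Z = torsion3 g nb X Y Z - torsion3 g nb (phi X) (phi Y) Z
    - torsion3 g nb (phi X) Y (phi Z) - torsion3 g nb X (phi Y) (phi Z).
Proof.
move=> HX HY HZ; rewrite (nijenhuis3_torsion nb)//; try by [exact: Hxi|exact: phi2].
by rewrite !compatible_dphi//; try exact: Hphi; ring.
Qed.

(** With [b] zero, d Phi evaluated on phi X, phi Y, phi Z consists exactly of the three terms of
    N_phi in which T carries two phi's, so the difference is T. *)
Lemma compatible_torsion_hhh X Y Z : H X -> H Y -> H Z ->
  torsion3 g nb X Y Z = nijenhuis3 s X Y Z
    - ext_d2 (fundamental_form s) (phi X) (phi Y) (phi Z).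
Proof.
move=> HX HY HZ; rewrite compatible_nijenhuis// (ext_d2_torsion metric_nb).
rewrite !compatible_dphi//; try exact: Hphi.
rewrite !phi2// /torsion3 !metricNr -!/(torsion3 g nb _ _ _).
rewrite (skewr (phi X) Y) (skewl X (phi Y)) (skewr (phi Y) X) ; ring.
Qed.

Lemma compatible_torsion_hhv X Y i : H X -> H Y ->
  torsion3 g nb X Y (xi i) = ext_d1 (eta i) X Y.
Proof.
move=> HX HY; have := metric_lie g nb X Y (xi i).
rewrite /ext_d1 HX HY !vfield0 !subr0 sub0r eta_metric => ->.
by rewrite -!eta_metric !nbH// !subr0 sub0r opprK.
Qed.

(** Differentiating the orthogonality of xi_i and [Y] moves the derivative to [Y], where it stays
    horizontal. *)
Lemma compatible_metric_xi X Y i : H Y -> g (nb X (xi i)) Y = 0.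
Proof.
move=> HY; have := metric_nb X (xi i) Y.
rewrite !(riem_sym g (xi i)) -!eta_metric nbH// HY vfield0 addr0.
by move=> <-.
Qed.

Lemma compatible_torsion_hvv X i j : H X ->
  torsion3 g nb X (xi i) (xi j) = - g (lie (xi i) (xi j)) X.
Proof.
move=> HX; rewrite (metric_lie g nb) !compatible_metric_xi// skewl skewr; ring.
Qed.

(** In terms of T, the tensor N_phi is T minus the sum of T with phi inserted in each pair of
    arguments, an expression that is skew because T is. *)
Lemma compatible_nijenhuis_form3 : form3_on H (nijenhuis3 s).
Proof.
have [T1 T2 T3 _] := skew_nb.
have E := compatible_nijenhuis.
split=> [u X X' Y Z HX HX' HY HZ|u X Y Y' Z HX HY HY' HZ
  |u X Y Z Z' HX HY HZ HZ'|X Y Z HX HY HZ].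
- have HuX : H (u *: X + X') by apply/horizontalD/HX'/horizontalZ.
  by rewrite !E// phiD phiZ !T1//; ring.
- have HuY : H (u *: Y + Y') by apply/horizontalD/HY'/horizontalZ.
  by rewrite !E// phiD phiZ !T2//; ring.
- have HuZ : H (u *: Z + Z') by apply/horizontalD/HZ'/horizontalZ.
  by rewrite !E// phiD phiZ !T3//; ring.
rewrite !E//; split.
  rewrite (skewl X Y) (skewl (phi X)) (skewl (phi X) Y) (skewl X (phi Y)); ring.
rewrite (skewr X Y) (skewr (phi X) (phi Y)) (skewr (phi X) Y) (skewr X (phi Y)); ring.
Qed.

(** With brackets written through nabla, the derivatives along xi_i cancel, the two torsion terms
    cancel by skew symmetry, and the derivatives of xi_i have no horizontal component. *)
Lemma compatible_lie_xi i X Y : H X -> H Y -> lie_metric (xi i) g X Y = 0.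
Proof.
move=> HX HY; rewrite /lie_metric metric_nb (riem_sym g X (lie _ _)) !(metric_lie g nb).
rewrite !compatible_metric_xi// (riem_sym g X) (skewr (xi i) Y X); ring.
Qed.

Lemma compatible_lie_h i j X : H X -> lie_metric X g (xi i) (xi j) = 0.
Proof.
move=> HX; rewrite /lie_metric metric_nb (riem_sym g (xi i) (lie _ _)) !(metric_lie g nb).
rewrite -!eta_metric !(nbH _ HX) !eta_metric (riem_sym g (xi i) (nb _ _)).
by rewrite (skewr X (xi j) (xi i)); ring.
Qed.

End necessary.

(** * Sufficiency: compatibility of the constructed connection *)

Section sufficient.
Hypothesis nijenhuis_form3 : form3_on H (nijenhuis3 s).
Hypothesis lie_xi : forall i X Y, H X -> H Y -> lie_metric (xi i) g X Y = 0.
Hypothesis lie_h : forall i j X, H X -> lie_metric X g (xi i) (xi j) = 0.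

Variable nb : connection M.
Hypothesis metric_nb : metric_connection g nb.
Hypothesis torsion_nb : forall X Y Z, torsion3 g nb X Y Z = candidate S s X Y Z.
Hypothesis koszul_nb : forall X Y Z,
  g (nb X Y) Z = half M * (koszul g X Y Z + candidate S s X Y Z).

Let cform3 : form3_on setT (candidate S s).
Proof. exact: candidate_form3. Qed.

Lemma candidate_skewl X Y Z : candidate S s X Y Z = - candidate S s Y X Z.
Proof. by case: cform3 => _ _ _ h; case: (h X Y Z I I I). Qed.

Lemma torsion_nb_skew : skew_torsion g nb.
Proof.
rewrite /skew_torsion (_ : torsion3 g nb = candidate S s)//.
by apply/funext => X; apply/funext => Y; apply/funext => Z.
Qed.

(** For horizontal A, the component of nabla_A Y along xi_k is minus half the Lie derivative of g
    along xi_k on A, Y. For A = xi_i it is half the Lie derivative of g along Y on xi_i, xi_k. The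
    direction [X] is split accordingly, since the prescribed torsion takes different forms on the
    two parts. *)
Lemma sufficient_horizontal X Y : H Y -> H (nb X Y).
Proof.
move=> HY; apply/horizontalP => k.
have hh A : H A -> g (nb A Y) (xi k) = 0.
  move=> HA; rewrite koszul_nb candidate_hhv//.
  have := lie_xi k HA HY; rewrite /lie_metric => E.
  rewrite /koszul eta_metric -!eta_metric HY HA !vfield0.
  rewrite (_ : _ + _ = - (xi k (g A Y) - g (lie (xi k) A) Y - g A (lie (xi k) Y)));
    first by rewrite E oppr0 mulr0.
  by rewrite (lieN (xi k) A) (lieN (xi k) Y) !metricNl (riem_sym g A (lie _ _)); ring.
have hv i : g (nb (xi i) Y) (xi k) = 0.
  rewrite koszul_nb candidate_skewl candidate_hvv//.
  have := lie_h i k HY; rewrite /lie_metric metric_xi => E.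
  rewrite /koszul metric_xi -!eta_metric HY (riem_sym g (xi i) Y) -eta_metric HY !vfield0.
  have Y0 : Y (i == k)%:R = 0.
    by case: (i == k); rewrite ?mulr1n ?mulr0n ?vfield1 ?vfield0.
  rewrite Y0 in E *.
  rewrite (_ : _ + _ = (0 - g (lie Y (xi i)) (xi k) - g (xi i) (lie Y (xi k))));
    first by rewrite E mulr0.
  rewrite !eta_metric (lieN Y (xi i)) metricNl (riem_sym g (xi i) (lie _ _)); ring.
rewrite (hpart_vpart S X) nablaDl metricDl hh; last exact: horizontal_hpart.
rewrite nabla_suml metric_suml big1 ?addr0// => i _.
by rewrite nablaZl metricZl hv mulr0.
Qed.

Lemma sufficient_vertical X Y : vertical S Y -> vertical S (nb X Y).
Proof.
move=> VY; apply: perp_vertical => Z HZ.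
have := metric_nb X Y Z; rewrite (vertical_perp VY HZ).
rewrite (vertical_perp VY (sufficient_horizontal X HZ)) vfield0 addr0.
by move=> <-.
Qed.

Local Notation b := (dphi nb s).

(* The contribution of [nabla phi] to the Nijenhuis tensor. *)
Let nb_part X Y Z := b (phi X) Y Z - b (phi Y) X Z - b Y X (phi Z) + b X Y (phi Z).

Let b_skew X Y Z : b X Z Y = - b X Y Z.
Proof. exact: dphi_skew. Qed.

Let b_phi X Y Z : H Y -> H Z -> b X (phi Y) Z = b X Y (phi Z).
Proof. by move=> HY HZ; apply: dphi_phi; exact: phi2. Qed.

Let nijenhuis_split X Y Z : H X -> H Y -> H Z ->
  nijenhuis3 s X Y Z = (torsion3 g nb X Y Z - torsion3 g nb (phi X) (phi Y) Z
      - torsion3 g nb (phi X) Y (phi Z) - torsion3 g nb X (phi Y) (phi Z))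
    + nb_part X Y Z.
Proof.
move=> HX HY HZ; apply: nijenhuis3_torsion; by [exact: Hxi|exact: phi2].
Qed.

(** The part of N_phi linear in T already has this symmetry, so the symmetry assumed for N_phi
    passes to the remaining part. *)
Let nb_part_skewr X Y Z : H X -> H Y -> H Z ->
  nb_part X Z Y = - nb_part X Y Z.
Proof.
move=> HX HY HZ; have [_ _ _ N4] := nijenhuis_form3.
have skewl := torsion3_skewl torsion_nb_skew.
have skewr := torsion3_skewr torsion_nb_skew.
have := proj2 (N4 X Y Z HX HY HZ); rewrite !nijenhuis_split//.
rewrite (skewr X Z Y) (skewr (phi X) (phi Z) Y) (skewr (phi X) Z) (skewr X (phi Z)).
move=> E; apply/eqP; rewrite -addr_eq0; apply/eqP.
move/eqP: E; rewrite -addr_eq0 => /eqP E; rewrite -[RHS]E; ring.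
Qed.

Let nb_part_skewl X Y Z : nb_part Y X Z = - nb_part X Y Z.
Proof. rewrite /nb_part; ring. Qed.

Let torsion_b X Y Z : H X -> H Y -> H Z ->
  b X Y (phi Z) - b Y X (phi Z) - b (phi Z) X Y = 0.
Proof.
move=> HX HY HZ.
have skewl := torsion3_skewl torsion_nb_skew.
have skewr := torsion3_skewr torsion_nb_skew.
have := torsion_nb X Y Z; rewrite candidate_hhh// /torsion_hhh.
rewrite nijenhuis_split// (ext_d2_torsion metric_nb) !phi2//.
rewrite /torsion3 !metricNr -!/(torsion3 g nb _ _ _).
have bphi2 A B C : H B -> H C -> b A (phi B) (phi C) = - b A B C.
  move=> HB HC; rewrite b_phi// ?phi2//; last exact: Hphi.
  by rewrite /dphi phiN !metricNr; ring.
rewrite !bphi2// (skewr (phi X) Y) (skewl X (phi Y)) (skewr (phi Y) X) /nb_part.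
rewrite (b_skew (phi Y) X Z) => E.
apply: (addrI (torsion3 g nb X Y Z)); rewrite addr0 [RHS]E; ring.
Qed.

(** The torsion identity is used at (X, Y, phi Z) and at (X, phi Y, Z). The terms other than b(X; Y,
    Z) in these two instances assemble into values of [nb_part] at (X, Z, phi Y) and (X, Y, phi Z),
    which are opposite by [E3], so twice b(X; Y, Z) is zero. *)
Lemma sufficient_dphi X Y Z : H X -> H Y -> H Z -> b X Y Z = 0.
Proof.
move=> HX HY HZ; apply: smoothfun_double_eq0.
have bN A B C : b A B (- C) = - b A B C by rewrite /dphi phiN !metricNr; ring.
have bNm A B C : b A (- B) C = - b A B C.
  by rewrite /dphi phiN !nablaNr !metricNl; ring.
have E1 := torsion_b HX HY (Hphi HZ).
have E2 := torsion_b HX (Hphi HY) HZ.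
have F1 : b X (phi Y) (phi Z) = - b X Y Z.
  by rewrite b_phi ?phi2 ?bN//; exact: Hphi.
have E3 : nb_part X Z (phi Y) = - nb_part X Y (phi Z).
  have P1 := nb_part_skewr HX (Hphi HY) HZ.
  have P2 := nb_part_skewl X (phi Y) Z.
  (* This shift of phi from the first to the last argument, combined with skew symmetry in both
     adjacent pairs, gives [E3]. *)
  have P3 : nb_part (phi Y) X Z = nb_part Y X (phi Z).
    by rewrite /nb_part !phi2// dphiNl !bN F1 (b_phi (phi X))//; ring.
  rewrite P1 -P2 P3 nb_part_skewl; ring.
have F2 : b (phi X) Z (phi Y) = - b (phi X) Y (phi Z).
  by rewrite -b_phi// b_skew.
have F3 : b X Z Y = - b X Y Z by [].
transitivity ((nb_part X Z (phi Y) + nb_part X Y (phi Z))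
  - (b X Y (phi (phi Z)) - b Y X (phi (phi Z)) - b (phi (phi Z)) X Y)
  - (b X (phi Y) (phi Z) - b (phi Y) X (phi Z) - b (phi Z) X (phi Y))).
  rewrite /nb_part !phi2// !bN dphiNl F1 F2 F3; ring.
by rewrite E1 E2 E3 addNr !subr0.
Qed.

Lemma sufficient_phi X Y : H X -> H Y -> nb X (phi Y) - phi (nb X Y) = 0.
Proof.
move=> HX HY; apply: (@horizontal_eq0 _ _ _ _ S) => [|Z HZ].
  apply: horizontalB; first exact/sufficient_horizontal/Hphi.
  exact/Hphi/sufficient_horizontal.
by rewrite metricDl metricNl phi_skew opprK -[LHS]/(b X Y Z) sufficient_dphi.
Qed.

End sufficient.
End compatible_connections.

Theorem theorem3p1p1 (R : realType) (n : nat) (M : manifold R (4 * n + 3))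
    (g : riem_metric M) (S : almost_3contact g) (s : acm_structure g)
    (s_in_sphere : assoc_sphere S s) :
  ((exists nb : connection M, compatible_connection S s nb) <->
   [/\ form3_on (horizontal S) (nijenhuis3 s),
       forall i X Y, horizontal S X -> horizontal S Y ->
         lie_metric (acm_xi (S i)) g X Y = 0 &
       forall i j X, horizontal S X ->
         lie_metric X g (acm_xi (S i)) (acm_xi (S j)) = 0]) /\
  (forall nb : connection M, compatible_connection S s nb ->
   forall X Y Z, horizontal S X -> horizontal S Y -> horizontal S Z ->
   forall i j : 'I_3,
   [/\ torsion3 g nb X Y Z = nijenhuis3 s X Y Z
         - ext_d2 (fundamental_form s) (acm_phi s X) (acm_phi s Y) (acm_phi s Z),
       torsion3 g nb X Y (acm_xi (S i)) = ext_d1 (acm_eta (S i)) X Y &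
       torsion3 g nb X (acm_xi (S i)) (acm_xi (S j)) =
         - g (lie (acm_xi (S i)) (acm_xi (S j))) X]).
Proof.
split; last first.
  move=> nb nbP X Y Z HX HY HZ i j; split.
  - exact: (compatible_torsion_hhh s_in_sphere nbP).
  - exact: (compatible_torsion_hhv nbP).
  - exact: (compatible_torsion_hvv nbP).
split=> [[nb nbP]|[c1 c2 c3]].
  split.
  - exact: (compatible_nijenhuis_form3 s_in_sphere nbP).
  - by move=> i X Y; exact: (compatible_lie_xi nbP).
  - by move=> i j X; exact: (compatible_lie_h nbP).
have [nb [n1 n2 n3]] := metric_connection_exists g (candidate_form3 c1).
exists nb; split=> //.
- exact: (torsion_nb_skew c1 n2).
- by move=> X Y; exact: (sufficient_horizontal c1 c2 c3 n3).
- by move=> X Y; exact: (sufficient_vertical c1 c2 c3 n1 n3).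
- by move=> X Y; exact: (sufficient_phi s_in_sphere c1 c2 c3 n1 n2 n3).
Qed.
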